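(* Let $\lambda>0$, $\rho_c=\frac{\lambda}{1+\lambda}$ and $a=\frac{\sqrt{\lambda}}{1+\lambda}$. For any $\varepsilon>0$, $$\lim_{N\to\infty}\mu^{(N)}\Big[\rho_c N+(a-\varepsilon)\sqrt{N\log N},\ \rho_c N+(a+\varepsilon)\sqrt{N\log N}\Big]=1,$$ where $\mu^{(N)}$ is the distribution of the total number of particles under the stationary distribution of the driven activated random walk Markov chain on the complete graph with $N$ non-boundary vertices and sleeping rate $\lambda$.
   Context: Fix the sleeping rate $\lambda>0$. Let $\mathcal{G}_{N+1}$ be the complete graph on $N+1$ vertices (no self-loops, no multiple edges), with one distinguished vertex called the boundary; let $\mathring V_{N+1}$ be the set of the remaining $N$ vertices. Activated random walk (ARW) dynamics (continuous time): particles are active (A) or sleeping (S). Each active particle performs an independent continuous-time simple random walk on $\mathcal{G}_{N+1}$ with jump rate $1$, and carries an independent Poisson clock of rate $\lambda$. When the clock of an active particle rings, the particle becomes sleeping if it does not share its vertex with another active particle; otherwise nothing happens. A sleeping particle does not move, and becomes active as soon as its vertex is visited by an active particle. A particle that jumps to the boundary vertex is instantaneously removed from the system. Driven chain: the state space is $\Sigma=\{0,s\}^{\mathring V_{N+1}}$, where $\xi(x)=s$ means that there is one sleeping particle at $x$ and $\xi(x)=0$ that $x$ is empty. Given $\xi_{n-1}\in\Sigma$, add an active particle at a vertex chosen uniformly at random in $\mathring V_{N+1}$ (if this vertex hosts a sleeping particle, that particle is activated) and run the ARW dynamics until, after an almost surely finite time, all particles remaining in $\mathring V_{N+1}$ are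 sleeping; the resulting configuration is $\xi_n\in\Sigma$. The Markov chain $(\xi_n)_{n\ge0}$ is irreducible and aperiodic on the finite set $\Sigma$; let $\bar\mu^{(N)}$ be its unique stationary distribution, and let $\mu^{(N)}$ be the distribution, on $\{0,1,\dots,N\}$, of the total number of particles under $\bar\mu^{(N)}$. *)

(* Defs.v *)
From HB Require Import structures.
From mathcomp Require Import all_boot all_order all_algebra.
From mathcomp Require Import all_classical all_reals all_analysis.

Set Implicit Arguments.
Unset Strict Implicit.
Unset Printing Implicit Defensive.

Import Order.TTheory GRing.Theory Num.Theory.
Import numFieldNormedType.Exports.

Local Open Scope classical_set_scope.
Local Open Scope ring_scope.

(* Vertices of the complete graph on N + 1 vertices; [None] is the boundary. *)
Definition vertex (N : nat) : finType := option 'I_N.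

Definition adj (N : nat) : rel (vertex N) := fun x y => x != y.

Definition degree (N : nat) (x : vertex N) : nat := #|[pred y | adj x y]|.

(* [None]: one sleeping particle; [Some k]: k active particles (so [Some 0] is
   an empty vertex). A sleeping particle never shares its vertex, because it is
   woken up by any active particle there. *)
Definition site : Type := option nat.

Definition config (N : nat) : Type := {ffun 'I_N -> site}.

Definition set_site (N : nat) (eta : config N) (x : 'I_N) (s : site) : config N :=
  [ffun y => if y == x then s else eta y].

Definition num_active (N : nat) (eta : config N) (x : 'I_N) : nat :=
  if eta x is Some k then k else 0%N.

(* On a sleeping site, the arriving particle wakes up the sleeper: 2 active. *)
Definition add_active (N : nat) (eta : config N) (x : 'I_N) : config N :=
  set_site eta x (Some (if eta x is Some k then k.+1 else 2)).

Definition remove_active (N : nat) (eta : config N) (x : 'I_N) : config N :=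
  set_site eta x (if eta x is Some k then Some k.-1 else None).

Definition jump (N : nat) (eta : config N) (x : 'I_N) (y : vertex N) : config N :=
  if y is Some z then add_active (remove_active eta x) z else remove_active eta x.

(* Effect of a clock ring of an active particle at x. *)
Definition clock_ring (N : nat) (eta : config N) (x : 'I_N) : config N :=
  if eta x == Some 1%N then set_site eta x None else eta.

(* Infinitesimal generator of the dynamics. Each of the [num_active eta x]
   active particles at x jumps at rate 1 to a uniform neighbour of x, and has a
   clock of rate lambda. *)
Definition generator (R : realType) (lambda : R) (N : nat) (f : config N -> R) :
    config N -> R := fun eta =>
  \sum_(x < N) (num_active eta x)%:R *
    (\sum_(y : vertex N | adj (Some x) y)
        (degree (Some x))%:R^-1 * (f (jump eta x y) - f eta)
     + lambda * (f (clock_ring eta x) - f eta)).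

(* The Markov semigroup exp (t * generator): [semigroup lambda t f eta] is the
   expectation of f at time t for the dynamics started from eta. The number of
   particles never increases, so only finitely many configurations are
   accessible from eta and the exponential series converges. *)
Definition semigroup (R : realType) (lambda t : R) (N : nat) (f : config N -> R)
    (eta : config N) : R :=
  limn (series (fun k : nat =>
    t ^+ k / k`!%:R * iter k (generator lambda (N := N)) f eta)).

Definition transition_prob (R : realType) (lambda t : R) (N : nat)
    (eta zeta : config N) : R :=
  semigroup lambda t (fun eta' => (eta' == zeta)%:R) eta.

(* The state space of the driven chain; [true] stands for s. *)
Definition stable_config (N : nat) : finType := {ffun 'I_N -> bool}.

Definition config_of_stable (N : nat) (xi : stable_config N) : config N :=
  [ffun x => if xi x then None else Some 0%N].

(* Probability that the dynamics started from eta stops in xi. Since xi is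
   absorbing, the events "the configuration at time t is xi" increase with t to
   the event "the final configuration is xi". *)
Definition stabilization_prob (R : realType) (lambda : R) (N : nat)
    (eta : config N) (xi : stable_config N) : R :=
  lim (transition_prob lambda t eta (config_of_stable xi) @[t --> +oo]).

Definition driven_kernel (R : realType) (lambda : R) (N : nat)
    (xi xi' : stable_config N) : R :=
  \sum_(x < N) N%:R^-1 *
    stabilization_prob lambda (add_active (config_of_stable xi) x) xi'.

Definition is_stationary (R : realType) (T : finType) (K : T -> T -> R)
    (m : T -> R) : Prop :=
  [/\ forall x, 0 <= m x,
      \sum_x m x = 1 &
      forall y, \sum_x m x * K x y = m y].

Definition num_particles (N : nat) (xi : stable_config N) : nat :=
  #|[pred x | xi x]|.

Definition num_particles_law (R : realType) (N : nat) (m : stable_config N -> R)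
    (k : 'I_N.+1) : R :=
  \sum_(xi | num_particles xi == k) m xi.

Definition interval_mass (R : realType) (N : nat) (p : 'I_N.+1 -> R)
    (I : interval R) : R :=
  \sum_(k < N.+1 | (k : nat)%:R \in I) p k.

(* Main.v *)
(** On the complete graph the dynamics has explicit harmonic functions. For a set
    [C] of [j] sites, the function [(j + 1)^(- number of particles)] times a product
    over [C] of site weights ([gamma = (N + 1) / (N lambda)] for a sleeping site,
    [-1] for an empty one, [0] for an active one) is harmonic for the generator
    and an eigenfunction of the driven chain, with an eigenvalue different from 1
    unless [C] is empty; hence its stationary mean vanishes for [C] nonempty.
    Summing over [C], and then over [j] with suitable signs and powers of [j + 1],
    gives for [1 <= n <= N] the positive "renewal equations"
      [sum_(k >= n) mu(k) E[(1 - U)^(N-k) (1 + gamma U)^k] = 1],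
    where [mu] is the law of the number of particles and [- ln U] is a
    Gamma([k - n + 1]) variable. For [k = rho_c N + x] the maximum over [U] of
    the integrand is about [expR (x^2 / (2 a^2 N))], which crosses [sqrt N] at
    [x = a sqrt (N ln N)]. Above this level, summing the equations over a window
    of values of [n] of that size gives each [k] a weight much larger than the
    size of the window, so there is little mass there; below it, all the weights
    are essentially at most 1, so that the mass above [n] has to be close to 1. *)
Require Import Defs.
From HB Require Import structures.
From mathcomp Require Import all_boot all_order all_algebra.
From mathcomp Require Import all_classical all_reals all_analysis.
From mathcomp Require Import ring lra zify.

Set Implicit Arguments.
Unset Strict Implicit.
Unset Printing Implicit Defensive.

Import Order.TTheory GRing.Theory Num.Theory.
Import numFieldNormedType.Exports.

Local Open Scope classical_set_scope.
Local Open Scope ring_scope.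

(** * Poisson averages of bounded sequences *)

(** A harmonic function says something about the driven chain only through optional stopping, and
    [stabilization_prob] is a limit in time of an exponential series in a generator with unbounded
    rates. On configurations with at most [n] particles the rates are bounded by some [c]. There,
    writing the generator as [c] times [uniformized c - 1] turns the series into a Poisson mean of
    iterates of a positive operator. Hence the Poisson averages: they replace the limit in
    continuous time by a limit of iterates.

    Two facts shape the asymptotic part. Above the critical level, the integrand is large only for
    [U] in an interval of length of order [v = sqrt (ln N / N)], which has small probability.
    Summing over about [2 ln N] consecutive equations restores a factor of order [1 / v], so the
    window gives to [k] a constant times the maximum. Below the critical level, single weights need
    not be close to 1: when [k - n] is of order [ln N] the only bound is [N^q] with [q < 1/2]. The
    equations must therefore be averaged over about [sqrt (N ln N)] values of [n], among which only
    order [ln N] are this close to a given [k]. *)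

Lemma sum_triangle (V : nmodType) (f : nat -> nat -> V) n :
  \sum_(0 <= k < n) \sum_(0 <= i < k.+1) f i (k - i)%N =
  \sum_(0 <= i < n) \sum_(0 <= j < n - i) f i j.
Proof.
elim: n => [|n IH]; first by rewrite !big_nil.
rewrite big_nat_recr //= IH [RHS]big_nat_recr //= subSnn big_nat1.
rewrite (big_nat_recr n) //= subnn addrA -big_split /=; congr (_ + _).
rewrite !big_nat; apply: eq_bigr => i /andP[_ lt_in].
by rewrite subSn ?(ltnW lt_in)// big_nat_recr.
Qed.

Section PoissonSums.
Variable R : realType.
Implicit Types (z t B : R) (q : nat -> R).

Lemma sum_exp_coeff_le z n : 0 <= z ->
  \sum_(0 <= i < n) z ^+ i / i`!%:R <= expR z.
Proof.
move=> z0; have /nondecreasing_cvgn_le/(_ (is_cvg_series_exp_coeff z) n) :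
    nondecreasing_seq (series (exp_coeff z)).
  apply/nondecreasing_seqP => m; rewrite seriesSr lerDl.
  by rewrite /exp_coeff /= divr_ge0 ?exprn_ge0.
by [].
Qed.

(** This is [expR z] times the expectation of [q] at a Poisson variable of parameter [z]. *)
Definition poisson_sum z q : R := limn (series (fun i => z ^+ i / i`!%:R * q i)).

Lemma cvg_poisson_sum z q B : (forall i, `|q i| <= B) ->
  series (fun i => z ^+ i / i`!%:R * q i) @ \oo --> poisson_sum z q.
Proof.
move=> qB; suff : cvgn (series (fun i => z ^+ i / i`!%:R * q i)) by [].
apply: normed_cvg.
apply: (@series_le_cvg _ _ (fun i => B * exp_coeff `|z| i)) => [i|i|i|] /=.
- by rewrite normr_ge0.
- by rewrite mulr_ge0 ?(le_trans _ (qB 0%N))// exp_coeff_ge0.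
- rewrite normrM mulrC ler_pM// /exp_coeff /= normrM normfV normrX.
  by rewrite [X in _ / X]ger0_norm.
- have -> : (fun i => B * exp_coeff `|z| i) = B *: exp_coeff `|z|.
    by apply/funext => i.
  by apply: is_cvg_seriesZ; exact: is_cvg_series_exp_coeff.
Qed.

Lemma norm_poisson_sum_le z q B M : 0 <= z -> (forall i, `|q i| <= B) ->
  (forall n, \sum_(0 <= i < n) z ^+ i / i`!%:R * `|q i| <= M) ->
  `|poisson_sum z q| <= M.
Proof.
move=> z0 qB qM; have cq := cvg_poisson_sum qB (z := z).
have cn : `|series (fun i => z ^+ i / i`!%:R * q i) n| @[n --> \oo] -->
  `|poisson_sum z q| by exact: cvg_norm.
rewrite -(cvg_lim _ cn)//; apply: limr_le; first by apply/cvg_ex; exists `|poisson_sum z q|.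
near=> n; apply: le_trans (ler_norm_sum _ _ _) _; apply: le_trans (qM n).
apply: ler_sum => i _; have c0 : 0 <= z ^+ i / i`!%:R by rewrite divr_ge0 ?exprn_ge0.
by rewrite normrM (ger0_norm c0).
Unshelve. all: by end_near. Qed.

Lemma poisson_sumD z q q' B B' : (forall i, `|q i| <= B) -> (forall i, `|q' i| <= B') ->
  poisson_sum z (fun i => q i + q' i) = poisson_sum z q + poisson_sum z q'.
Proof.
move=> qB qB'; rewrite /poisson_sum -lim_seriesD.
- by congr (limn (series _)); apply/funext => i; rewrite mulrDr.
- by apply/cvg_ex; exists (poisson_sum z q); exact: cvg_poisson_sum qB.
- by apply/cvg_ex; exists (poisson_sum z q'); exact: cvg_poisson_sum qB'.
Qed.

Lemma poisson_sum_cst z l : poisson_sum z (fun=> l) = l * expR z.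
Proof.
have -> : l * expR z = l *: limn (series (exp_coeff z)) by [].
rewrite -lim_seriesZ; last exact: is_cvg_series_exp_coeff.
by congr (limn (series _)); apply/funext => i; rewrite mulrC.
Qed.

Lemma poisson_mean_cvg0 q B : (forall i, `|q i| <= B) -> q @ \oo --> 0 ->
  expR (- z) * poisson_sum z q @[z --> +oo] --> 0.
Proof.
move=> qB /cvgr0Pnorm_le q0; have B0 : 0 <= B := le_trans (normr_ge0 _) (qB 0%N).
apply/cvgr0Pnorm_le => /= e e0.
have [m _ qm] := q0 (e / 2) (divr_gt0 e0 (ltr0Sn _ 1)).
(* The bound [B] on the first [m] terms is traded for [B m / (i + 1)], whose Poisson mean is
   explicit: the weight [z^i / i!] divided by [i + 1] is the next weight divided by [z]. The mean is
   then at most [e / 2 + B m / z]. *)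
have {}qm i : `|q i| <= e / 2 + B * m%:R / i.+1%:R.
  have [lt_im|le_mi] := ltnP i m; last first.
    by rewrite (le_trans (qm i _))// lerDl divr_ge0 ?mulr_ge0.
  rewrite (le_trans (qB i))// -[leLHS]add0r lerD ?divr_ge0 ?(ltW e0)//.
  by rewrite -mulrA ler_peMr// ler_pdivlMr// mul1r ler_nat.
near=> z; have z_gt0 : 0 < z by near: z; exact: nbhs_pinfty_gt.
have bnd : `|poisson_sum z q| <= (e / 2 + B * m%:R / z) * expR z.
  apply: (@norm_poisson_sum_le _ _ B) => //.
  move=> n; apply: le_trans (_ : e / 2 * (\sum_(0 <= i < n) z ^+ i / i`!%:R) +
      B * m%:R / z * (\sum_(0 <= i < n.+1) z ^+ i / i`!%:R) <= _); last first.
    rewrite mulrDl lerD// ler_wpM2l ?sum_exp_coeff_le ?(ltW z_gt0)//.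
      by rewrite divr_ge0// ltW.
    by rewrite divr_ge0 ?mulr_ge0// ltW.
  rewrite (big_nat_recl n)//= mulrDr addrCA -[leLHS]add0r lerD//.
    by rewrite !mulr_ge0// ?invr_ge0 ?(ltW z_gt0).
  rewrite !mulr_sumr -big_split /=; apply: ler_sum => i _.
  apply: le_trans (ler_wpM2l _ (qm i)) _; first by rewrite divr_ge0 ?exprn_ge0 ?(ltW z_gt0).
  rewrite factS natrM exprS -subr_ge0.
  set a := i.+1%:R; set b := i`!%:R.
  have a0 : a != 0 by rewrite pnatr_eq0.
  have b0 : b != 0 by rewrite pnatr_eq0 -lt0n fact_gt0.
  clearbody a b; rewrite le_eqVlt; apply/orP; left; apply/eqP.
  by field; rewrite a0 b0 gt_eqF.
rewrite normrM gtr0_norm ?expR_gt0// expRN ler_pdivrMl ?expR_gt0// mulrC.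
apply: le_trans bnd _; rewrite ler_wpM2r ?expR_ge0//.
rewrite -lerBrDl; have -> : e - e / 2 = e / 2 by field.
rewrite ler_pdivrMr// -ler_pdivrMl ?divr_gt0//.
Unshelve. all: by end_near. Qed.

Lemma poisson_mean_cvg q B (l : R) : (forall i, `|q i| <= B) -> q @ \oo --> l ->
  expR (- z) * poisson_sum z q @[z --> +oo] --> l.
Proof.
move=> qB ql; have qBl i : `|q i - l| <= B + `|l| by rewrite (le_trans (ler_normB _ _))// lerD2r.
have -> : (fun z => expR (- z) * poisson_sum z q) =
    (fun z => expR (- z) * poisson_sum z (fun i => q i - l) + l).
  apply/funext => z.
  rewrite (@poisson_sumD _ q (fun=> - l) _ `|l| qB) => [|i]; last by rewrite normrN.
  by rewrite poisson_sum_cst expRN; field; rewrite gt_eqF ?expR_gt0.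
rewrite -[X in _ --> X]add0r; apply: cvgD; last exact: cvg_cst.
apply: poisson_mean_cvg0 qBl _.
by rewrite -(subrr l); apply: cvgB => //; exact: cvg_cst.
Qed.

(** The series is the Cauchy product of those of [expR (- z)] and [poisson_sum z q]. When [q i] is
    the [i]-th iterate of an operator [T], the inner sum is the [k]-th power of [T - 1]; this is how
    the exponential series of the generator enters. *)
Lemma cvg_binomial_transform z q B : 0 <= z -> (forall i, `|q i| <= B) ->
  series (fun k => z ^+ k / k`!%:R *
    \sum_(0 <= i < k.+1) (-1) ^+ (k - i) * 'C(k, i)%:R * q i) @ \oo -->
  expR (- z) * poisson_sum z q.
Proof.
move=> z0 qB; have B0 : 0 <= B := le_trans (normr_ge0 _) (qB 0%N).
pose f x i j : R := x ^+ j / j`!%:R * (z ^+ i / i`!%:R).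
have triangle x n : \sum_(0 <= i < n) \sum_(0 <= j < n - i) f x i j =
    \sum_(0 <= k < n) \sum_(0 <= i < k.+1) f x i (k - i)%N by rewrite sum_triangle.
have binom x k (y : nat -> R) : \sum_(0 <= i < k.+1) f x i (k - i)%N * y i =
    k`!%:R^-1 * \sum_(0 <= i < k.+1) (x ^+ (k - i) * z ^+ i * 'C(k, i)%:R * y i).
  rewrite mulr_sumr !big_nat; apply: eq_bigr => i /andP[_]; rewrite ltnS => le_ik.
  rewrite -(bin_fact le_ik) !natrM /f.
  have := fact_gt0 i; have := fact_gt0 (k - i); have := bin_gt0 k i.
  rewrite le_ik -!(ltr0n R) => /lt0r_neq0 ? /lt0r_neq0 ? /lt0r_neq0 ?.
  by field; repeat (apply/andP; split).
pose E n := series (exp_coeff z) n.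
have cE : E @ \oo --> expR z by exact: is_cvg_series_exp_coeff.
have cE2 : series (exp_coeff (z + z)) @ \oo --> expR z * expR z.
  by rewrite -expRD; exact: is_cvg_series_exp_coeff.
pose q_ n := series (fun i => z ^+ i / i`!%:R * q i) n.
pose e_ n := series (exp_coeff (- z)) n.
set c_ := series _.
have cprod : (fun n => e_ n * q_ n) @ \oo --> expR (- z) * poisson_sum z q.
  by apply: cvgM; [exact: is_cvg_series_exp_coeff | exact: cvg_poisson_sum qB].
(* The partial product and the partial Cauchy sum differ by the corner [i + j >= n]. In absolute
   value it is at most [B] times the same corner for [expR z * expR z], which is the difference of
   two sequences with the same limit. *)
have bnd n : `|e_ n * q_ n - c_ n| <= B * (E n * E n - series (exp_coeff (z + z)) n).
  have split_prod x (y : nat -> R) : series (exp_coeff x) n *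
      series (fun i => z ^+ i / i`!%:R * y i) n =
      \sum_(0 <= i < n) \sum_(0 <= j < n - i) f x i j * y i
      + \sum_(0 <= i < n) \sum_(n - i <= j < n) f x i j * y i.
    rewrite -big_split /= /series /= mulr_sumr; apply: eq_bigr => i _.
    rewrite -big_cat_nat ?leq_subr//= mulr_suml; apply: eq_bigr => j _.
    by rewrite /f /exp_coeff /= mulrA.
  have -> : c_ n = \sum_(0 <= i < n) \sum_(0 <= j < n - i) f (- z) i j * q i.
    rewrite -sum_triangle; apply: eq_bigr => k _.
    rewrite binom -mulrA mulrCA; congr (_ * _).
    rewrite mulr_sumr !big_nat; apply: eq_bigr => i /andP[_]; rewrite ltnS => le_ik.
    by rewrite -[in z ^+ k](subnK le_ik) exprD (exprNn z); ring.
  rewrite split_prod addrC addKr.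
  have -> : E n * E n - series (exp_coeff (z + z)) n =
      \sum_(0 <= i < n) \sum_(n - i <= j < n) f z i j.
    have -> : series (exp_coeff (z + z)) n = \sum_(0 <= i < n) \sum_(0 <= j < n - i) f z i j * 1.
      rewrite -sum_triangle; apply: eq_bigr => k _; rewrite (binom z k (fun=> 1)).
      rewrite /exp_coeff /= exprDn mulrC big_mkord; congr (_ * _).
      by apply: eq_bigr => i _; rewrite mulr1 mulr_natr.
    have EE : E n = series (fun i => z ^+ i / i`!%:R * 1) n.
      by apply: eq_bigr => i _; rewrite mulr1.
    rewrite {2}EE /E split_prod addrC addKr.
    by do 2!apply: eq_bigr => ? _; rewrite mulr1.
  apply: le_trans (ler_norm_sum _ _ _) _; rewrite mulr_sumr; apply: ler_sum => i _.
  apply: le_trans (ler_norm_sum _ _ _) _; rewrite mulr_sumr; apply: ler_sum => j _.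
  rewrite normrM mulrC ler_pM// /f !normrM !normfV normrX normrN.
  by rewrite !ger0_norm ?exprn_ge0.
have -> : expR (- z) * poisson_sum z q = expR (- z) * poisson_sum z q - 0 by rewrite subr0.
have -> : c_ = (fun n => e_ n * q_ n - (e_ n * q_ n - c_ n)).
  by apply/funext => n; rewrite opprB addrCA subrr addr0.
apply: cvgB => //; apply: norm_cvg0.
apply: (@squeeze_cvgr _ _ _ _ (cst 0) (fun n => B * (E n * E n - series (exp_coeff (z + z)) n))).
- by near=> n; rewrite normr_ge0 bnd.
- exact: cvg_cst.
- have -> : 0 = B * (expR z * expR z - expR z * expR z) by rewrite subrr mulr0.
  by apply: cvgMl_tmp; apply: cvgB => //; apply: cvgM.
Unshelve. all: by end_near. Qed.

End PoissonSums.

(** * The generator and its stabilization probabilities *)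

Section Configurations.
Variable N : nat.
Implicit Types (eta : config N) (x : 'I_N).

Definition site_size (s : site) : nat := if s is Some k then k else 1%N.

Definition total eta : nat := \sum_x site_size (eta x).

Definition active eta : nat := \sum_x num_active eta x.

Lemma degree_site x : degree (Some x : vertex N) = N.
Proof.
have cN : #|predC1 (Some x : vertex N)| = N by rewrite cardC1 card_option card_ord.
by apply: etrans cN; apply: eq_card => y; rewrite !inE /adj eq_sym.
Qed.

Lemma card_adj x : #|[pred y | adj (Some x : vertex N) y]| = N.
Proof. exact: degree_site. Qed.

Lemma total_set_site eta x s :
  (total (set_site eta x s) + site_size (eta x) = total eta + site_size s)%N.
Proof.
rewrite /total (bigD1 x)//= [in RHS](bigD1 x)//= ffunE eqxx.
rewrite [X in (_ + X + _)%N](eq_bigr (fun y => site_size (eta y))).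
  by rewrite addnAC [RHS]addnAC (addnC (site_size s)).
by move=> y /negPf yx; rewrite ffunE yx.
Qed.

Lemma total_add_active eta x : total (add_active eta x) = (total eta).+1.
Proof.
have := total_set_site eta x (Some (if eta x is Some k then k.+1 else 2)).
by rewrite -/(add_active eta x); case: (eta x) => [k|] /=; lia.
Qed.

Lemma total_remove_active eta x : (0 < num_active eta x)%N ->
  (total (remove_active eta x)).+1 = total eta.
Proof.
rewrite /num_active => ax.
have := total_set_site eta x (if eta x is Some k then Some k.-1 else None).
by rewrite -/(remove_active eta x); case: (eta x) ax => [[|k]|] //=; lia.
Qed.

Lemma total_jump eta x (y : vertex N) : (0 < num_active eta x)%N ->
  (total (jump eta x y) + ~~ y = total eta)%N.
Proof.
move=> ax; case: y => [z|] /=; last by rewrite addn1 total_remove_active.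
by rewrite total_add_active total_remove_active// addn0.
Qed.

Lemma total_jump_le eta x (y : vertex N) : (0 < num_active eta x)%N ->
  (total (jump eta x y) <= total eta)%N.
Proof. by move=> ax; rewrite -(total_jump y ax) leq_addr. Qed.

Lemma total_clock_ring eta x : total (clock_ring eta x) = total eta.
Proof.
rewrite /clock_ring; case: eqP => // ex.
by have := total_set_site eta x None; rewrite ex /=; lia.
Qed.

Lemma active_le_total eta : (active eta <= total eta)%N.
Proof.
by apply: leq_sum => x _; rewrite /num_active /site_size; case: (eta x).
Qed.

End Configurations.

(** * The generator, its effect on the number of particles, and uniformization *)

Section Dynamics.
Variables (R : realType) (lambda : R) (N : nat).
Hypothesis (N_gt0 : (0 < N)%N).
Implicit Types (eta zeta : config N) (f g h : config N -> R) (x : 'I_N).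

Lemma sum_adj_inv x (a : R) :
  \sum_(y : vertex N | adj (Some x) y) (degree (Some x : vertex N))%:R^-1 * a = a.
Proof.
rewrite sumr_const card_adj degree_site -[LHS]mulr_natl mulrA divff ?mul1r//.
by rewrite pnatr_eq0 -lt0n.
Qed.

Lemma generator_lin (a : R) f g eta :
  generator lambda (fun z => a * f z + g z) eta =
  a * generator lambda f eta + generator lambda g eta.
Proof.
rewrite /generator mulr_sumr -big_split /=; apply: eq_bigr => x _.
rewrite mulrCA -mulrDr; congr (_ * _).
rewrite [a * (_ + _)]mulrDr [a * \sum_(_ | _) _]mulr_sumr addrACA -big_split /=; congr (_ + _); last by ring.
by apply: eq_bigr => y _; ring.
Qed.

Lemma generatorE f eta : generator lambda f eta =
  \sum_x (num_active eta x)%:R *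
    (\sum_(y : vertex N | adj (Some x) y) N%:R^-1 * f (jump eta x y)
       + lambda * f (clock_ring eta x))
  - (1 + lambda) * (active eta)%:R * f eta.
Proof.
rewrite /generator /active natr_sum mulr_sumr mulr_suml -sumrB.
apply: eq_bigr => x _; rewrite degree_site.
have -> : \sum_(y | adj (Some x) y) N%:R^-1 * (f (jump eta x y) - f eta) =
   \sum_(y | adj (Some x) y) N%:R^-1 * f (jump eta x y) - f eta.
  rewrite -[f eta in RHS](sum_adj_inv x) degree_site -sumrB.
  by apply: eq_bigr => y _; rewrite mulrBr.
by ring.
Qed.

Lemma generator_absorbing f eta : active eta = 0%N -> generator lambda f eta = 0.
Proof.
move/eqP; rewrite /active sum_nat_eq0 => /forallP a0; rewrite /generator big1// => x _.
by have /eqP -> := a0 x; rewrite mul0r.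
Qed.

(** Only a jump to the boundary, one neighbour out of [N], changes the number of particles. This
    makes [total] a Lyapunov function for stabilization. *)
Lemma generator_total eta :
  generator lambda (fun z => (total z)%:R) eta = - (active eta)%:R / N%:R.
Proof.
rewrite /generator /active natr_sum mulNr mulr_suml -sumrN; apply: eq_bigr => x _.
have [->|ax] := posnP (num_active eta x); first by rewrite !mul0r oppr0.
rewrite total_clock_ring subrr mulr0 addr0 -mulrN; congr (_ * _).
rewrite degree_site (bigD1 (None : vertex N))//= big1 ?addr0.
  by rewrite -(total_remove_active ax) -natr1 opprD addrA subrr add0r mulrN1.
by move=> y /andP[_ y0]; rewrite -(total_jump y ax); case: y y0 => // z _;
  rewrite addn0 subrr mulr0.
Qed.

(** Transition operator of the discrete-time chain whose steps occur at rate [c]. It is positive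
    only where the total jump rate is at most [c]. *)
Definition uniformized (c : R) f : config N -> R :=
  fun eta => f eta + c^-1 * generator lambda f eta.

(** Pascal's rule for iterated finite differences; it is the induction step of [iter_generator], the
    binomial expansion of the powers of [c (uniformized c - 1)]. *)
Lemma sum_binomial_diff (q : nat -> R) k :
  \sum_(0 <= i < k.+1) (-1) ^+ (k - i) * 'C(k, i)%:R * (q i.+1 - q i) =
  \sum_(0 <= i < k.+2) (-1) ^+ (k.+1 - i) * 'C(k.+1, i)%:R * q i.
Proof.
rewrite [RHS]big_nat_recl//= bin0.
have -> : \sum_(0 <= i < k.+1) (-1) ^+ (k.+1 - i.+1) * 'C(k.+1, i.+1)%:R * q i.+1 =
    \sum_(0 <= i < k.+1) (-1) ^+ (k - i) * 'C(k, i)%:R * q i.+1 +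
    \sum_(0 <= i < k.+1) (-1) ^+ (k - i) * 'C(k, i.+1)%:R * q i.+1.
  by rewrite -big_split /=; apply: eq_bigr => i _; rewrite binS natrD subSS; ring.
rewrite addrCA.
have -> : (-1) ^+ (k.+1 - 0) * 1%:R * q 0%N +
    \sum_(0 <= i < k.+1) (-1) ^+ (k - i) * 'C(k, i.+1)%:R * q i.+1 =
    \sum_(0 <= i < k.+2) (-1) ^+ (k.+1 - i) * 'C(k, i)%:R * q i.
  by rewrite [RHS]big_nat_recl//= bin0; congr (_ + _); apply: eq_bigr => i _; rewrite subSS.
rewrite [X in _ = _ + X]big_nat_recr//= bin_small// mulr0 mul0r addr0 -big_split /=.
rewrite !big_nat; apply: eq_bigr => i /andP[_]; rewrite ltnS => le_ik.
by rewrite subSn// exprS; ring.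
Qed.

Lemma iter_generator (c : R) f k : c != 0 ->
  iter k (generator lambda (N := N)) f =
  fun eta => c ^+ k * \sum_(0 <= i < k.+1)
    (-1) ^+ (k - i) * 'C(k, i)%:R * iter i (uniformized c) f eta.
Proof.
move=> c0; elim: k => [|k IH]; apply/funext => eta.
  by rewrite big_nat1 /= subnn bin0 !mul1r.
have gen_unif g : generator lambda g eta = c * (uniformized c g eta - g eta).
  by rewrite /uniformized; field.
have gen_sum (s : seq nat) (a : nat -> R) (g : nat -> config N -> R) :
    generator lambda (fun z => \sum_(i <- s) a i * g i z) eta =
    \sum_(i <- s) a i * generator lambda (g i) eta.
  elim: s => [|i s IHs].
    rewrite big_nil /generator big1// => x _; rewrite !big_nil subrr mulr0 addr0.
    by rewrite big1 ?mulr0// => y _; rewrite !big_nil subrr mulr0.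
  rewrite big_cons -IHs -generator_lin; congr (generator _ _ _).
  by apply/funext => z; rewrite big_cons.
rewrite iterS IH.
have -> : (fun z => c ^+ k * \sum_(0 <= i < k.+1)
      (-1) ^+ (k - i) * 'C(k, i)%:R * iter i (uniformized c) f z) =
    (fun z => \sum_(0 <= i < k.+1)
      (c ^+ k * ((-1) ^+ (k - i) * 'C(k, i)%:R)) * iter i (uniformized c) f z).
  by apply/funext => z; rewrite mulr_sumr; apply: eq_bigr => i _; rewrite mulrA.
rewrite gen_sum -sum_binomial_diff mulr_sumr; apply: eq_bigr => i _.
by rewrite gen_unif exprS -iterS; ring.
Qed.

End Dynamics.

(** * Optional stopping for bounded harmonic functions *)

Section Stabilization.
Variables (R : realType) (lambda : R) (N : nat).
Hypotheses (lambda_gt0 : 0 < lambda) (N_gt0 : (0 < N)%N).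
Implicit Types (eta zeta : config N) (f g h : config N -> R) (x : 'I_N).

Local Notation gen := (@generator R lambda N).
Local Notation unif c := (@uniformized R lambda N c).

Lemma uniformized_lin c (a : R) f g :
  unif c (fun z => a * f z + g z) = fun eta => a * unif c f eta + unif c g eta.
Proof. by apply/funext => eta; rewrite /uniformized generator_lin; ring. Qed.

Lemma iter_uniformized_lin c (a : R) f g k :
  iter k (unif c) (fun z => a * f z + g z) =
  fun eta => a * iter k (unif c) f eta + iter k (unif c) g eta.
Proof. by elim: k => //= k ->; rewrite uniformized_lin. Qed.

Lemma iter_uniformized_fix c h k : (forall eta, gen h eta = 0) -> iter k (unif c) h = h.
Proof.
move=> gh; elim: k => //= k ->; apply/funext => eta.
by rewrite /uniformized gh mulr0 addr0.
Qed.

Lemma iter_uniformized_sum c (T : Type) (s : seq T) (a : T -> R) (f : T -> config N -> R) k :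
  iter k (unif c) (fun z => \sum_(i <- s) a i * f i z) =
  fun eta => \sum_(i <- s) a i * iter k (unif c) (f i) eta.
Proof.
elim: s => [|i s IH].
  have -> : (fun z : config N => \sum_(i <- [::]) a i * f i z) = cst 0.
    by apply/funext => z; rewrite big_nil.
  rewrite iter_uniformized_fix; first by apply/funext => eta; rewrite big_nil.
  by move=> eta; rewrite generatorE// big1 ?mulr0 ?subr0// => x _; rewrite big1 => [|y _]; rewrite !mulr0 ?addr0 ?mulr0.
have -> : (fun z => \sum_(j <- i :: s) a j * f j z) =
    (fun z => a i * f i z + \sum_(j <- s) a j * f j z).
  by apply/funext => z; rewrite big_cons.
by rewrite iter_uniformized_lin IH; apply/funext => eta; rewrite big_cons.
Qed.

Section UpTo.
Variables (n : nat) (c : R).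
Hypothesis c_ge : (1 + lambda) * n.+1%:R <= c.

Let c_gt0 : 0 < c.
Proof. by apply: lt_le_trans c_ge; rewrite mulr_gt0 ?addr_gt0. Qed.

(* On configurations with at most [n] particles the jump rates are at most [c]. *)
Lemma uniformized_ge0 f : (forall eta, (total eta <= n)%N -> 0 <= f eta) ->
  forall eta, (total eta <= n)%N -> 0 <= unif c f eta.
Proof.
move=> f0 eta le_n; rewrite /uniformized generatorE// mulrBr addrCA addrA -addrA addr_ge0//.
  rewrite mulr_ge0 ?invr_ge0 ?(ltW c_gt0)//; apply: sumr_ge0 => x _.
  have [->|ax] := posnP (num_active eta x); first by rewrite mul0r.
  rewrite mulr_ge0// addr_ge0//.
    apply: sumr_ge0 => y _; apply: mulr_ge0; first by rewrite invr_ge0.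
    by apply: f0; exact: leq_trans (total_jump_le y ax) le_n.
  by rewrite mulr_ge0 ?(ltW lambda_gt0)// f0// total_clock_ring.
rewrite subr_ge0 ler_pdivrMl// ler_wpM2r ?f0//.
apply: le_trans c_ge; rewrite ler_wpM2l ?addr_ge0 ?(ltW lambda_gt0)// ler_nat.
by rewrite (leq_trans (active_le_total _))// ltnW.
Qed.

Lemma iter_uniformized_le f g k :
  (forall eta, (total eta <= n)%N -> f eta <= g eta) ->
  forall eta, (total eta <= n)%N -> iter k (unif c) f eta <= iter k (unif c) g eta.
Proof.
move=> fg eta le_n; rewrite -subr_ge0.
have -> : iter k (unif c) g eta - iter k (unif c) f eta =
    iter k (unif c) (fun z => -1 * f z + g z) eta.
  by rewrite iter_uniformized_lin mulN1r addrC.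
elim: k eta le_n => [|k IH] eta le_n /=; first by rewrite mulN1r addrC subr_ge0 fg.
exact: uniformized_ge0 le_n.
Qed.

Lemma gen_cst (a : R) eta : gen (fun=> a) eta = 0.
Proof.
rewrite /generator big1// => x _; rewrite big1 => [|y _]; last by rewrite subrr mulr0.
by rewrite subrr mulr0 addr0 mulr0.
Qed.

Lemma norm_iter_uniformized_le f (B : R) k :
  (forall eta, (total eta <= n)%N -> `|f eta| <= B) ->
  forall eta, (total eta <= n)%N -> `|iter k (unif c) f eta| <= B.
Proof.
move=> fB eta le_n; rewrite ler_norml.
have cstE (a : R) : a = iter k (unif c) (fun=> a) eta.
  by rewrite iter_uniformized_fix// => z; rewrite gen_cst.
by rewrite {1}(cstE (- B)) {2}(cstE B) !iter_uniformized_le// => z /fB; rewrite ler_norml => /andP[].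
Qed.

(** Expanding the powers of the generator in iterates of [unif c] turns the defining series into a
    binomial transform at [c t], so its convergence and its value come together. *)
Lemma semigroupE f (B : R) t eta : 0 <= t ->
  (forall eta, (total eta <= n)%N -> `|f eta| <= B) -> (total eta <= n)%N ->
  semigroup lambda t f eta =
  expR (- (c * t)) * poisson_sum (c * t) (fun i => iter i (unif c) f eta).
Proof.
move=> t0 fB le_n; apply: cvg_lim => //.
have ct0 : 0 <= c * t by rewrite mulr_ge0// ltW.
apply: cvg_trans (cvg_binomial_transform ct0
  (fun i => norm_iter_uniformized_le i fB le_n)).
apply: near_eq_cvg; near=> m; apply: eq_bigr => k _.
rewrite (iter_generator _ _ _ (c := c)) ?gt_eqF// exprMn.
by ring.
Unshelve. all: by end_near. Qed.

Lemma lim_semigroup f (B l : R) eta :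
  (forall eta, (total eta <= n)%N -> `|f eta| <= B) -> (total eta <= n)%N ->
  iter k (unif c) f eta @[k --> \oo] --> l ->
  semigroup lambda t f eta @[t --> +oo] --> l.
Proof.
move=> fB le_n fl.
have := poisson_mean_cvg (fun i => norm_iter_uniformized_le i fB le_n) fl.
have ct : c * t @[t --> +oo] --> +oo.
  apply/cvgryPge => A; near=> t; rewrite -ler_pdivrMl//.
move=> /(cvg_comp _ _ ct); apply: cvg_trans; apply: near_eq_cvg.
near=> t; rewrite /= (semigroupE _ fB)//.
Unshelve. all: by end_near. Qed.

Definition unstable eta : R := (0 < active eta)%:R.

Lemma uniformized_unstable_le eta : (total eta <= n)%N ->
  unif c unstable eta <= unstable eta.
Proof.
move=> le_n; have [a0|a_gt0] := posnP (active eta).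
  by rewrite /uniformized generator_absorbing// mulr0 addr0.
rewrite [leRHS]/unstable a_gt0 -[leRHS](_ : iter 1 (unif c) (fun=> 1) eta = 1).
  by apply: (@iter_uniformized_le _ _ 1) => // z _; rewrite /unstable lern1 leq_b1.
by rewrite iter_uniformized_fix// => z; rewrite gen_cst.
Qed.

(** While the configuration is unstable, each step of [unif c] lowers the mean of [total] by at
    least [1 / (c N)]. So the probabilities of being unstable at the first [k] times add up to at
    most [c N] times the initial total. As they decrease in time, [k] times the last one is below
    their sum. *)
Lemma iter_unstable_le eta k : (total eta <= n)%N ->
  k%:R * iter k (unif c) unstable eta <= c * N%:R * (total eta)%:R.
Proof.
move=> le_n; have N0 : (0 : R) < N%:R by rewrite ltr0n.
pose V zeta : R := (total zeta)%:R.
have sum_le : \sum_(0 <= i < k) iter i (unif c) unstable eta <=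
    c * N%:R * (V eta - iter k (unif c) V eta).
  elim: k => [|k IH]; first by rewrite big_nil /= subrr mulr0.
  rewrite big_nat_recr//=; apply: le_trans (lerD IH (lexx _)) _.
  rewrite -lerBrDl -mulrBr opprB addrC addrA subrK -ler_pdivrMl ?mulr_gt0// lerBrDl -lerBrDr.
  rewrite -iterS iterSr [leRHS](_ : _ = iter k (unif c)
      (fun z => - (c * N%:R)^-1 * unstable z + V z) eta); last first.
    by rewrite iter_uniformized_lin mulNr addrC.
  apply: iter_uniformized_le le_n => z _.
  rewrite /uniformized generator_total// addrC lerD2r mulNr mulNr mulrN lerN2.
  rewrite invfM -mulrA ler_pM2l ?invr_gt0// mulrC ler_pM2r ?invr_gt0//.
  by rewrite /unstable ler_nat; case: (active z).
apply: le_trans (_ : \sum_(0 <= i < k) iter i (unif c) unstable eta <= _).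
  have -> : k%:R * iter k (unif c) unstable eta = \sum_(0 <= i < k) iter k (unif c) unstable eta.
    by rewrite sumr_const_nat subn0 -[RHS]mulr_natl.
  rewrite !big_nat; apply: ler_sum => i /andP[_ /ltnW le_ik].
  rewrite -(subnK le_ik) addnC iterD; apply: iter_uniformized_le le_n => z le_z.
  elim: (k - i)%N => // m IH; rewrite iterSr; apply: le_trans IH.
  by apply: iter_uniformized_le le_z => w; exact: uniformized_unstable_le.
apply: le_trans sum_le _; rewrite ler_pM2l ?mulr_gt0// gerBl.
rewrite -[leLHS](_ : iter k (unif c) (fun=> 0) eta = 0); first exact: iter_uniformized_le.
by rewrite iter_uniformized_fix// => z; rewrite gen_cst.
Qed.

Definition stable_indicator (xi : stable_config N) eta : R :=
  (eta == config_of_stable xi)%:R.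

Lemma iter_unstable_cvg0 eta : (total eta <= n)%N ->
  iter k (unif c) unstable eta @[k --> \oo] --> (0 : R).
Proof.
move=> le_n; set M : R := c * N%:R * (total eta)%:R.
(* [harmonic i] is [1 / (i + 1)], so the bound is [M / k] for positive [k]. *)
apply: (@squeeze_cvgr _ _ _ _ (cst 0) (fun k => M * harmonic k.-1)).
- near=> k; have k0 : (0 < k)%N by near: k; exact: nbhs_infty_gt.
  rewrite -[leLHS](_ : iter k (unif c) (fun=> 0) eta = 0); last first.
    by rewrite iter_uniformized_fix// => z; rewrite gen_cst.
  rewrite iter_uniformized_le//= prednK// ler_pdivlMr ?ltr0n// mulrC.
  exact: iter_unstable_le.
- exact: cvg_cst.
- rewrite -(mulr0 M); apply: cvgMl_tmp.
  by rewrite -(cvg_shiftn 1); apply: cvg_trans (@cvg_harmonic R); apply: near_eq_cvg;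
    near=> k; rewrite /= addn1.
Unshelve. all: by end_near. Qed.

Lemma active0_config_of_stable eta : active eta = 0%N ->
  eta = config_of_stable [ffun x => eta x == None].
Proof.
move/eqP; rewrite /active sum_nat_eq0 => /forallP a0; apply/ffunP => x; rewrite !ffunE.
by have := a0 x; rewrite /num_active; case: (eta x) => [k /eqP ->|].
Qed.

Lemma active_config_of_stable (xi : stable_config N) : active (config_of_stable xi) = 0%N.
Proof.
by apply/eqP; rewrite /active sum_nat_eq0; apply/forallP => x; rewrite /num_active ffunE; case: ifP.
Qed.

Lemma config_of_stable_inj : injective (@config_of_stable N).
Proof.
by move=> xi xi' /ffunP e; apply/ffunP => x; have := e x; rewrite !ffunE; do 2!case: ifP.
Qed.

(** Stable configurations are absorbing, so the iterates increase with [k] and are bounded by 1.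
    Their limit is also that of the semigroup by [lim_semigroup], which gives a value to the [lim]
    in [stabilization_prob]. *)
Lemma iter_stable_indicator_cvg (xi : stable_config N) eta : (total eta <= n)%N ->
  iter k (unif c) (stable_indicator xi) eta @[k --> \oo] --> stabilization_prob lambda eta xi.
Proof.
move=> le_n; set q := fun k => _.
have ind_le1 z : `|stable_indicator xi z| <= 1 by rewrite normr_nat lern1 leq_b1.
have cq : cvgn q.
  apply: nondecreasing_is_cvgn.
    apply/nondecreasing_seqP => k; rewrite /q iterSr; apply: iter_uniformized_le le_n => z le_zn.
    rewrite {1}/stable_indicator; case: eqP => [->|_].
      rewrite /uniformized generator_absorbing ?active_config_of_stable//.
      by rewrite mulr0 addr0 /stable_indicator eqxx.
    by apply: uniformized_ge0 le_zn => ? _; rewrite /stable_indicator ler0n.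
  exists 1 => _ [k _ <-]; apply: le_trans (ler_norm _) _.
  exact: norm_iter_uniformized_le (fun z _ => ind_le1 z) _ le_n.
rewrite /stabilization_prob (cvg_lim _ (lim_semigroup (fun z _ => ind_le1 z) le_n cq))//.
Qed.

End UpTo.

(** Split [h] into its values on stable configurations and the remainder [h * unstable]. Iterating
    [unif c] fixes [h], sends the stable indicators to the stabilization probabilities, and kills
    the remainder, which is dominated by [B] times the probability of being unstable. *)
Lemma expect_stabilization h (B : R) eta :
  (forall zeta, `|h zeta| <= B) -> (forall zeta, gen h zeta = 0) ->
  \sum_xi stabilization_prob lambda eta xi * h (config_of_stable xi) = h eta.
Proof.
move=> hB gh; pose n := total eta; pose c : R := (1 + lambda) * n.+1%:R.
pose r z := h z * unstable z.
have hE : h = fun z => 1 * (\sum_xi h (config_of_stable xi) * stable_indicator xi z) + r z.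
  apply/funext => z; rewrite mul1r /r; have [a0|a_gt0] := posnP (active z).
    rewrite /unstable a0 mulr0 addr0 {1 2}(active0_config_of_stable a0).
    set xi := [ffun x => _]; rewrite (bigD1 xi)//= /stable_indicator eqxx mulr1 big1 ?addr0//.
    move=> xi' ne; case: eqP => [/config_of_stable_inj e|_]; last by rewrite mulr0.
    by rewrite e eqxx in ne.
  rewrite /unstable a_gt0 mulr1 big1 ?add0r// => xi _; rewrite /stable_indicator.
  by case: eqP => [e|_]; [rewrite e active_config_of_stable in a_gt0 | rewrite mulr0].
have split k : h eta - \sum_xi h (config_of_stable xi) * iter k (unif c) (stable_indicator xi) eta =
    iter k (unif c) r eta.
  have : h eta = iter k (unif c) h eta by rewrite iter_uniformized_fix.
  rewrite {2}hE iter_uniformized_lin iter_uniformized_sum mul1r => {1}->.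
  by rewrite addrC addKr.
have r0 : iter k (unif c) r eta @[k --> \oo] --> (0 : R).
  have cu := iter_unstable_cvg0 (n := n) (c := c) (lexx _) (leqnn _).
  apply: norm_cvg0; apply: (@squeeze_cvgr _ _ _ _ (cst 0)
    (fun k => B * iter k (unif c) unstable eta)).
  - near=> k; rewrite /= normr_ge0 /= ler_norml.
    have lin (a : R) : a * iter k (unif c) unstable eta =
        iter k (unif c) (fun z => a * unstable z + 0) eta.
      rewrite iter_uniformized_lin [X in _ + X](_ : _ = 0) ?addr0//.
      by rewrite iter_uniformized_fix// => z; rewrite gen_cst.
    rewrite -mulNr !lin.
    have u0 z : 0 <= unstable z by rewrite /unstable ler0n.
    by apply/andP; split; apply: (@iter_uniformized_le n) => // z _; rewrite /r addr0
      ler_wpM2r//; have := hB z; rewrite ler_norml => /andP[].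
  - exact: cvg_cst.
  - by rewrite -(mulr0 B); apply: cvgMl_tmp.
have sum_cvg : \sum_xi h (config_of_stable xi) * iter k (unif c) (stable_indicator xi) eta
    @[k --> \oo] --> \sum_xi stabilization_prob lambda eta xi * h (config_of_stable xi).
  apply: cvg_big => //; first exact: add_continuous.
  move=> xi _; rewrite mulrC; apply: cvgMl_tmp.
  exact: (@iter_stable_indicator_cvg n).
have : h eta - \sum_xi h (config_of_stable xi) * iter k (unif c) (stable_indicator xi) eta
    @[k --> \oo] --> h eta - \sum_xi stabilization_prob lambda eta xi * h (config_of_stable xi).
  by apply: cvgB => //; exact: cvg_cst.
under eq_fun do rewrite split.
move=> hr; apply/esym/eqP; rewrite -subr_eq0; apply/eqP.
exact: (norm_cvg_unique (V := R^o) hr r0).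
Unshelve. all: by end_near. Qed.

End Stabilization.

(** * Iterated averages of polynomials *)

Section IteratedAverages.
Variable R : realType.
Implicit Types (P Q : {poly R}).

(* [average P] at y is (1/y) times the integral of [P] over [0, y]. *)
Definition average P : {poly R} := \poly_(j < size P) (P`_j / j.+1%:R).

Definition unaverage P : {poly R} := ('X * P)^`().

Lemma coef_average P j : (average P)`_j = P`_j / j.+1%:R.
Proof. by rewrite coef_poly; case: ltnP => // /(nth_default 0) ->; rewrite mul0r. Qed.

Lemma coef_unaverage P j : (unaverage P)`_j = j.+1%:R * P`_j.
Proof. by rewrite coef_deriv coefXM /= mulr_natl. Qed.

Lemma averageK P : unaverage (average P) = P.
Proof.
by apply/polyP => j; rewrite coef_unaverage coef_average mulrC divfK ?pnatr_eq0.
Qed.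

Lemma coef_iter_average P k j : (iter k average P)`_j = P`_j / j.+1%:R ^+ k.
Proof.
elim: k => [|k IH]; first by rewrite expr0 divr1.
by rewrite iterS coef_average IH exprS invfM; ring.
Qed.

Lemma coef_iter_unaverage P k j : (iter k unaverage P)`_j = P`_j * j.+1%:R ^+ k.
Proof.
by elim: k => [|k IH]; rewrite ?mulr1// iterS coef_unaverage IH exprS; ring.
Qed.

(** This is the expectation of [P] at a product [U] of [l + 1] independent uniform variables, so
    that [- ln U] is Gamma([l + 1]): each [average] multiplies the argument by one more uniform
    variable. *)
Definition mean l P : R := (iter l.+1 average P).[1].

Lemma meanE l P n : (size P <= n)%N ->
  mean l P = \sum_(0 <= j < n) P`_j / j.+1%:R ^+ l.+1.
Proof.
move=> le_n; rewrite /mean (@horner_coef_wide _ n).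
  by rewrite big_mkord; apply: eq_bigr => j _; rewrite expr1n mulr1 coef_iter_average.
by apply/leq_sizeP => j le_nj; rewrite coef_iter_average (leq_sizeP _ _ le_n)// mul0r.
Qed.

Lemma meanD l P Q : mean l (P + Q) = mean l P + mean l Q.
Proof.
pose n := maxn (size P) (size Q).
rewrite !(@meanE _ _ n) ?leq_maxl ?leq_maxr ?size_polyD//.
by rewrite -big_split /=; apply: eq_bigr => j _; rewrite coefD mulrDl.
Qed.

Lemma meanZ l a P : mean l (a *: P) = a * mean l P.
Proof.
rewrite !(@meanE _ _ (size P)) ?size_scale_leq// mulr_sumr.
by apply: eq_bigr => j _; rewrite coefZ mulrA.
Qed.

Lemma meanXn l j : mean l 'X^j = (j.+1%:R ^+ l.+1)^-1.
Proof.
rewrite (@meanE _ _ j.+1) ?size_polyXn// big_nat_recr//= big_nat big1 ?add0r.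
  by rewrite coefXn eqxx mul1r.
by move=> i /andP[_ lt_ij]; rewrite coefXn (ltn_eqF lt_ij) mul0r.
Qed.

(** Each [unaverage] is a derivative and lowers the order of the zero at 1 by at most one, so [k] of
    them leave a zero of order at least 1. *)
Lemma horner_unaverage_eq0 k P : (iter k unaverage ((1 - 'X) ^+ k.+1 * P)).[1] = 0.
Proof.
suff H m : exists Q, iter k unaverage ((1 - 'X) ^+ (m + k) * P) = (1 - 'X) ^+ m * Q.
  have [Q] := H 1%N; rewrite add1n => ->.
  by rewrite !hornerE /= subrr mul0r.
elim: k m P => [|k IH] m P; first by exists P; rewrite addn0.
rewrite iterSr addnS.
have -> : unaverage ((1 - 'X) ^+ (m + k).+1 * P) = (1 - 'X) ^+ (m + k) *
    ((1 - 'X) * ('X * P)^`() - (m + k).+1%:R *: ('X * P)).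
  rewrite /unaverage (mulrCA 'X) [LHS]derivM deriv_exp derivB derivX derivC /= sub0r.
  by rewrite -mulr_natl exprS -mul_polyC polyC_natr; ring.
exact: IH.
Qed.

End IteratedAverages.

(** * Harmonic functions and the renewal equations *)

Section Eigenfunctions.
Variables (R : realType) (lambda : R) (N : nat).
Hypotheses (lambda_gt0 : 0 < lambda) (N_gt0 : (0 < N)%N).
Implicit Types (eta : config N) (x : 'I_N) (C : {set 'I_N}).

Definition odds : R := N.+1%:R / (N%:R * lambda).

Let N_neq0 : N%:R != 0 :> R. Proof. by rewrite pnatr_eq0 -lt0n. Qed.

Let card_neq0 C : 1 + #|C|%:R != 0 :> R. Proof. by rewrite addrC natr1 pnatr_eq0. Qed.

Definition site_weight (s : site) : R :=
  match s with None => odds | Some 0 => -1 | Some _ => 0 end.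

Definition weight C eta : R := \prod_(z in C) site_weight (eta z).

Definition eigenfun C eta : R := #|C|.+1%:R ^- total eta * weight C eta.

Lemma weight_set_site_notin C eta x s : x \notin C ->
  weight C (set_site eta x s) = weight C eta.
Proof.
move=> xC; apply: eq_bigr => z zC; rewrite ffunE; case: eqP => // zx.
by rewrite -zx zC in xC.
Qed.

Lemma weight_set_site_in C eta x s : x \in C ->
  weight C (set_site eta x s) = site_weight s * weight (C :\ x) eta.
Proof.
move=> xC; rewrite /weight (big_setD1 x)//= ffunE eqxx; congr (_ * _).
by apply: eq_bigr => z; rewrite !inE ffunE => /andP[/negPf ->].
Qed.

Lemma weight_add_active C eta x :
  weight C (add_active eta x) = if x \in C then 0 else weight C eta.
Proof.
rewrite /add_active; case: ifPn => xC; last by rewrite weight_set_site_notin.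
by rewrite weight_set_site_in//; case: (eta x) => [k|] /=; rewrite mul0r.
Qed.

Lemma sum_adj (F : vertex N -> R) x :
  \sum_(y | adj (Some x) y) F y = F None + \sum_(z | z != x) F (Some z).
Proof.
rewrite (bigD1 None)//=; congr (_ + _).
rewrite (reindex_omap Some id)//=; last by case=> // z.
apply: eq_bigl => z; rewrite /adj eqxx !andbT eq_sym.
by [].
Qed.

(** A jump to the boundary removes a particle and gains a factor [#|C| + 1]. Landing in [C] gives 0,
    since an active site of [C] has weight 0. Each remaining target leaves the weight unchanged. *)
Lemma sum_eigenfun_jump C eta x : (0 < num_active eta x)%N ->
  \sum_(y | adj (Some x) y) N%:R^-1 * eigenfun C (jump eta x y) =
  N%:R^-1 * #|C|.+1%:R ^- total eta * weight C (remove_active eta x) *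
    (#|C|.+1 + #|~: C :\ x|)%:R.
Proof.
move=> ax; rewrite sum_adj /= natrD mulrDr; congr (_ + _).
  rewrite /eigenfun -(total_remove_active ax) exprS invfM; field.
  by rewrite N_neq0 expf_neq0 ?card_neq0 ?pnatr_eq0.
have -> : #|~: C :\ x|%:R = \sum_(z | z != x) (z \notin C)%:R :> R.
  rewrite -sum1_card natr_sum big_mkcond [RHS]big_mkcond /=; apply: eq_bigr => z _.
  by rewrite !inE; case: (z != x) => //=; case: (z \in C).
rewrite mulr_sumr; apply: eq_bigr => z _.
rewrite /eigenfun total_add_active total_remove_active// weight_add_active.
by case: (z \in C); rewrite ?mulr0 ?mulr1// mulrA.
Qed.

Lemma weight_active_eq0 C eta x : x \in C -> (0 < num_active eta x)%N -> weight C eta = 0.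
Proof.
rewrite /num_active => xC ax; rewrite /weight (big_setD1 x)//=.
by case: (eta x) ax => [[|k]|]//=; rewrite mul0r.
Qed.

Lemma card_setC_ord C : (#|C| + #|~: C| = N)%N.
Proof. by rewrite cardsC card_ord. Qed.

(** From a site outside [C], the targets count for [(#|C| + 1) + (N - #|C| - 1) = N], which balances
    the rate of leaving; this dictates the base [#|C| + 1]. From a site of [C] with one active
    particle they count for [N + 1], with the sign [-1] of the vacated site, and falling asleep
    compensates exactly when [lambda * odds = (N + 1) / N]. With more active particles every term is
    0. *)
Lemma generator_eigenfun C eta : generator lambda (eigenfun C) eta = 0.
Proof.
rewrite generatorE// /active natr_sum mulr_sumr mulr_suml -sumrB big1// => x _.
have [->|ax] := posnP (num_active eta x); first by rewrite mul0r mulr0 mul0r subrr.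
rewrite [(1 + lambda) * _]mulrC -mulrA -mulrBr sum_eigenfun_jump//.
apply/eqP; rewrite mulf_eq0; apply/orP; right; apply/eqP.
have cC := card_setC_ord C.
have r0 : #|C|.+1%:R ^+ total eta != 0 :> R by rewrite expf_neq0 ?pnatr_eq0.
have [xC|xC] := boolP (x \in C).
  have xCC : ~: C :\ x = ~: C.
    by apply/setP => z; rewrite !inE; case: eqP => // ->; rewrite xC.
  rewrite xCC addSn cC [eigenfun C eta]/eigenfun (weight_active_eq0 xC ax) mulr0 mulr0 subr0.
  rewrite /remove_active weight_set_site_in// /eigenfun total_clock_ring /clock_ring.
  move: ax; rewrite /num_active; case ex: (eta x) => [[|[|k]]|]//= _.
    rewrite weight_set_site_in//= /odds; field.
    by rewrite (gt_eqF lambda_gt0) N_neq0 r0.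
  rewrite (@weight_active_eq0 C eta x)// ?/num_active ?ex//.
  by rewrite !(mulr0, mul0r) addr0.
have card_x : (#|C|.+1 + #|~: C :\ x| = N)%N.
  by apply: etrans cC; rewrite (cardsD1 x (~: C)) inE xC add1n addnS.
rewrite card_x /remove_active weight_set_site_notin// /eigenfun total_clock_ring /clock_ring.
case: eqP => _; rewrite ?weight_set_site_notin//; field; by rewrite N_neq0 r0.
Qed.

Lemma sum_eigenfun_add_active C eta :
  \sum_x N%:R^-1 * eigenfun C (add_active eta x) =
  (N - #|C|)%:R / (N%:R * #|C|.+1%:R) * eigenfun C eta.
Proof.
have -> : (N - #|C| = #|~: C|)%N by have := card_setC_ord C; lia.
rewrite -sum1_card natr_sum !mulr_suml [RHS]big_mkcond /=; apply: eq_bigr => x _.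
rewrite /eigenfun total_add_active weight_add_active !inE exprS invfM.
by case: (x \in C); rewrite /= ?mulr0//; field; rewrite N_neq0 card_neq0 expf_neq0 ?card_neq0 ?pnatr_eq0.
Qed.

Lemma eigenfun_bounded C : {B : R | forall eta, `|eigenfun C eta| <= B}.
Proof.
exists ((1 + odds) ^+ #|C|) => eta.
have odds0 : 0 <= odds by rewrite divr_ge0 ?mulr_ge0// ltW.
rewrite normrM -[leRHS]mul1r ler_pM//.
  by rewrite normfV ger0_norm ?exprn_ge0// invf_le1 ?exprn_gt0//; apply: exprn_ege1; rewrite ler1n.
rewrite normr_prod -prodr_const; apply: ler_prod => x _; rewrite normr_ge0 /=.
case: (eta x) => [[|k]|] /=; rewrite ?normrN ?normr1 ?normr0 ?(ger0_norm odds0).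
- by rewrite lerDl.
- by rewrite addr_ge0.
- by rewrite lerDr.
Qed.

Lemma stationary_eigenfun (m : stable_config N -> R) C :
  is_stationary (driven_kernel lambda (N := N)) m -> (0 < #|C|)%N ->
  \sum_xi m xi * eigenfun C (config_of_stable xi) = 0.
Proof.
case=> _ _ mK C0; set E := LHS.
have [B hB] := eigenfun_bounded C.
have EE : E = (N - #|C|)%:R / (N%:R * #|C|.+1%:R) * E.
  rewrite {1}/E (eq_bigr (fun xi' => \sum_xi m xi * (driven_kernel lambda xi xi' *
      eigenfun C (config_of_stable xi')))); last first.
    by move=> xi' _; rewrite -mK mulr_suml; apply: eq_bigr => xi _; rewrite mulrA.
  rewrite exchange_big /= /E mulr_sumr; apply: eq_bigr => xi _.
  rewrite -mulr_sumr mulrCA -sum_eigenfun_add_active; congr (_ * _).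
  under eq_bigr do rewrite /driven_kernel mulr_suml.
  rewrite exchange_big /=; apply: eq_bigr => x _.
  (* Optional stopping is used backwards: the mean of the eigenfunction over the final
     configurations is its value just after the addition. *)
  rewrite -(expect_stabilization lambda_gt0 N_gt0 _ hB (generator_eigenfun C)).
  by rewrite [RHS]mulr_sumr; apply: eq_bigr => xi' _; rewrite -mulrA.
have k1 : (N - #|C|)%:R / (N%:R * #|C|.+1%:R) != 1 :> R.
  rewrite lt_eqF// ltr_pdivrMr ?mulr_gt0 ?ltr0n// mul1r -natrM ltr_nat.
  by apply: leq_ltn_trans (leq_subr _ _) _; rewrite mulnS -[X in (X < _)%N]addn0 ltn_add2l muln_gt0 N_gt0.
apply/eqP; move/eqP: EE; rewrite -subr_eq0 -{1}[E]mul1r -mulrBl mulf_eq0 subr_eq0.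
by rewrite eq_sym (negPf k1).
Qed.

(* Indexed by the number [k] of sleeping particles; its coefficients are, up to
   normalization, Krawtchouk polynomials in [k]. *)
Definition krawtchouk_gen (k : nat) : {poly R} :=
  (1 - 'X) ^+ (N - k) * (1 + odds *: 'X) ^+ k.

(** The left side is an elementary symmetric function of the site weights, hence a coefficient of
    the product of the factors [1 + psi x X]; this product only depends on the number of sleeping
    sites. *)
Lemma sum_weight_stable (xi : stable_config N) j :
  \sum_(C : {set 'I_N} | #|C| == j) weight C (config_of_stable xi) =
  (krawtchouk_gen (num_particles xi))`_j.
Proof.
pose psi x : R := site_weight (config_of_stable xi x).
have -> : krawtchouk_gen (num_particles xi) = \prod_x (psi x *: 'X + 1).
  rewrite (bigID xi) /= [RHS]mulrC; congr (_ * _).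
    rewrite (eq_bigr (fun=> 1 - 'X)); last first.
      by move=> x /negPf xi0; rewrite /psi ffunE xi0 /= scaleN1r addrC.
    rewrite prodr_const; congr (_ ^+ _); rewrite /num_particles.
    have cC := cardC [pred x | xi x]; rewrite card_ord in cC.
    have eC : #|[predC [pred x | xi x]]| = #|(fun i : 'I_N => ~~ xi i)| by exact: eq_card.
    rewrite eC in cC.
    by have aux (a b n : nat) : (a + b = n -> n - a = b)%N; [lia | exact: aux cC].
  rewrite (eq_bigr (fun=> 1 + odds *: 'X)); last first.
    by move=> x xi1; rewrite /psi ffunE xi1 /= addrC.
  by rewrite prodr_const; congr (_ ^+ _); apply: eq_card.
rewrite bigA_distr coef_sum [LHS]big_mkcond; apply: eq_bigr => C _.
have -> : \prod_i (if i \in C then psi i *: 'X else 1) = weight C (config_of_stable xi) *: 'X^#|C|.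
  by rewrite -big_mkcond /= -prodr_const -scaler_prod.
by rewrite coefZ coefXn eq_sym; case: eqP; rewrite ?mulr1 ?mulr0.
Qed.

Lemma total_config_of_stable (xi : stable_config N) :
  total (config_of_stable xi) = num_particles xi.
Proof.
rewrite /total /num_particles -sum1_card [RHS]big_mkcond; apply: eq_bigr => x _.
by rewrite ffunE inE; case: ifP.
Qed.

Lemma law_moment (m : stable_config N -> R) j :
  is_stationary (driven_kernel lambda (N := N)) m ->
  \sum_(k < N.+1) num_particles_law m k * (j.+1%:R ^- k * (krawtchouk_gen k)`_j) = (j == 0)%:R.
Proof.
move=> st; have lt_num xi : (@num_particles N xi < N.+1)%N.
  by rewrite ltnS -[X in (_ <= X)%N]card_ord max_card.
have -> : \sum_(k < N.+1) num_particles_law m k * (j.+1%:R ^- k * (krawtchouk_gen k)`_j) =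
    \sum_xi m xi * (j.+1%:R ^- num_particles xi * (krawtchouk_gen (num_particles xi))`_j).
  rewrite [RHS](partition_big (fun xi => Ordinal (lt_num xi)) xpredT)//=.
  apply: eq_bigr => k _; rewrite mulr_suml; apply: eq_big => [xi|xi /eqP ->//].
  by rewrite -val_eqE.
case: j => [|j].
  case: st => _ m1 _; rewrite -[RHS]m1; apply: eq_bigr => xi _.
  rewrite expr1n invr1 mul1r /krawtchouk_gen -horner_coef0 !hornerE /=.
  by rewrite subr0 !expr1n !mulr1.
have -> : \sum_xi m xi * (j.+2%:R ^- num_particles xi *
      (krawtchouk_gen (num_particles xi))`_j.+1) =
    \sum_(C : {set 'I_N} | #|C| == j.+1) \sum_xi m xi * eigenfun C (config_of_stable xi).
  rewrite exchange_big /=; apply: eq_bigr => xi _.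
  rewrite -sum_weight_stable !mulr_sumr; apply: eq_bigr => C /eqP cC.
  by rewrite /eigenfun total_config_of_stable cC.
by rewrite big1// => C /eqP cC; rewrite stationary_eigenfun// cC.
Qed.

Definition renewal (k n : nat) : R :=
  if (n <= k)%N then mean (k - n) (krawtchouk_gen k) else 0.

Lemma size_krawtchouk_gen k : (k <= N)%N -> (size (krawtchouk_gen k) <= N.+1)%N.
Proof.
move=> kN; have size_lin (a : R) : (size (1 + a *: 'X : {poly R})%R <= 2)%N.
  rewrite (leq_trans (size_polyD _ _))// geq_max size_poly1 /=.
  by rewrite (leq_trans (size_scale_leq _ _))// size_polyX.
have size_exp (p : {poly R}) n : (size p <= 2)%N -> (size (p ^+ n)%R <= n.+1)%N.
  move=> p2; apply: leq_trans (size_poly_exp_leq _ _) _; rewrite ltnS.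
  by rewrite -[X in (_ <= X)%N]mul1n leq_mul2r; case: (size p) p2 => [|[|[|]]]//=; rewrite orbT.
have s1 := size_exp _ (N - k)%N (size_lin (-1)); have s2 := size_exp _ k (size_lin odds).
rewrite scaleN1r in s1; apply: leq_trans (size_polyMleq _ _) _.
have aux a b : (a <= (N - k).+1 -> b <= k.+1 -> (a + b).-1 <= N.+1)%N by lia.
exact: aux.
Qed.

(** For [k >= n] the powers of [j + 1] combine to the exponent [-(k - n + 1)], which [mean]
    produces. For [k < n] the exponent [n - 1 - k] is nonnegative and the sum is an iterated
    [unaverage] at 1. It vanishes because [n <= N] makes this exponent smaller than the order
    [N - k] of the zero of the polynomial. *)
Lemma renewalE k n : (0 < n <= N)%N -> (k <= N)%N ->
  renewal k n = \sum_(0 <= j < N.+1) j.+1%:R ^+ n.-1 * (j.+1%:R ^- k * (krawtchouk_gen k)`_j).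
Proof.
move=> /andP[n0 nN] kN; have j0 j : j.+1%:R != 0 :> R by rewrite pnatr_eq0.
rewrite /renewal; case: leqP => [nk|kn].
  rewrite (meanE _ (size_krawtchouk_gen kN)); apply: eq_bigr => j _.
  rewrite mulrA mulrC; congr (_ * _).
  have -> : k = ((k - n).+1 + n.-1)%N by lia.
  rewrite exprD invfM mulrCA divff ?expf_neq0// mulr1; congr (_ ^- _); lia.
have := horner_unaverage_eq0 (n.-1 - k) ((1 - 'X) ^+ (N - n) * (1 + odds *: 'X) ^+ k).
rewrite mulrA -exprD (_ : (n.-1 - k).+1 + (N - n) = N - k)%N; last by lia.
rewrite -/(krawtchouk_gen k) => /esym eq0; apply: (etrans eq0).
rewrite (@horner_coef_wide _ N.+1); last first.
  apply/leq_sizeP => j jN; rewrite coef_iter_unaverage.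
  by rewrite (leq_sizeP _ _ (size_krawtchouk_gen kN))// mul0r.
rewrite big_mkord; apply: eq_bigr => j _; rewrite expr1n mulr1 coef_iter_unaverage.
rewrite mulrA mulrC; congr (_ * _).
by rewrite -[in RHS](subnK (_ : k <= n.-1)%N) ?exprD ?mulfK ?expf_neq0//; lia.
Qed.

Lemma renewal_equation (m : stable_config N -> R) n :
  is_stationary (driven_kernel lambda (N := N)) m -> (0 < n <= N)%N ->
  \sum_(k < N.+1) num_particles_law m k * renewal k n = 1.
Proof.
move=> st nN.
rewrite (eq_bigr (fun k : 'I_N.+1 => \sum_(0 <= j < N.+1) num_particles_law m k *
    (j.+1%:R ^+ n.-1 * (j.+1%:R ^- k * (krawtchouk_gen k)`_j)))); last first.
  by move=> k _; rewrite (renewalE nN (ltn_ord k : (k <= N)%N)) mulr_sumr.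
rewrite exchange_big /=.
rewrite (eq_bigr (fun j => j.+1%:R ^+ n.-1 * (j == 0%N)%:R)); last first.
  move=> j _; rewrite -(law_moment j st) mulr_sumr.
  by apply: eq_bigr => k _; rewrite mulrCA.
rewrite big_nat_recl//= expr1n mul1r big1 ?addr0// => j _.
by rewrite mulr0.
Qed.

End Eigenfunctions.

(** * Estimates for a fixed number of sites *)

Section RealInequalities.
Variable R : realType.
Implicit Types (a b c s x y z u : R) (p : {poly R}).

Lemma ler_derive (f df : R -> R) a b : a <= b ->
  (forall x, a <= x <= b -> is_derive x 1 f (df x)) ->
  (forall x, a < x < b -> 0 <= df x) -> f a <= f b.
Proof.
rewrite le_eqVlt => /predU1P[->//|ab] fdf df0.
have [||c cab] := @MVT R f df a b ab.
- by move=> x; rewrite in_itv /= => /andP[ax xb]; apply: fdf; rewrite !ltW.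
- apply: derivable_within_continuous => x; rewrite in_itv /= => xab.
  exact: (@ex_derive _ _ _ _ _ _ _ (fdf x xab)).
rewrite -subr_ge0 => ->; rewrite mulr_ge0 ?subr_ge0 ?(ltW ab)//.
by apply: df0; move: cab; rewrite in_itv.
Qed.

Lemma is_derive_ln_comp (f : R -> R) (df : R) x :
  0 < f x -> is_derive x 1 f df -> is_derive x 1 (fun y => ln (f y)) (df / f x).
Proof.
move=> fx0 fdf.
have := @is_derive1_comp R (@ln R) f x _ _ (is_derive1_ln fx0) fdf.
by rewrite mulrC.
Qed.

(** Common source of the four logarithm bounds that follow: in each of them [p] is a quadratic
    polynomial for which the derivative is a fraction of evident sign. *)
Lemma ler_ln_poly s c p b : 0 <= b ->
  (forall x, 0 <= x <= b -> 0 < 1 + c * x) ->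
  (forall x, 0 < x < b -> 0 <= s * (c / (1 + c * x)) + p^`().[x]) ->
  p.[0] <= s * ln (1 + c * b) + p.[b].
Proof.
move=> b0 c_gt0 d_ge0; pose q : {poly R} := 1 + c *: 'X.
have qE x : q.[x] = 1 + c * x by rewrite /q !hornerE.
have -> : p.[0] = s * ln (1 + c * 0) + p.[0] by rewrite mulr0 addr0 ln1 mulr0 add0r.
apply: (@ler_derive (fun x => s * ln (1 + c * x) + p.[x])
  (fun x => s * (c / (1 + c * x)) + p^`().[x])) => // x /c_gt0 cx.
have dq : is_derive x 1 (fun y => ln q.[y]) (c / (1 + c * x)).
  rewrite -qE; have -> : c = q^`().[x] by rewrite /q derivD -[1]/1%:P derivC derivZ derivX add0r hornerZ hornerC mulr1.
  by apply: is_derive_ln_comp; rewrite ?qE.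
have -> : (fun y => s * ln (1 + c * y) + p.[y]) = (s *: (fun y => ln q.[y])) + horner p.
  by apply/funext => y /=; rewrite -qE.
by apply: is_deriveD; exact: is_deriveZ.
Qed.

Lemma ln1D_ge z : 0 <= z -> z - z ^+ 2 / 2 <= ln (1 + z).
Proof.
move=> z0; pose k : R := 2^-1; pose p : {poly R} := - 'X + k *: 'X^2.
have hp y : p.[y] = - y + k * y ^+ 2 by rewrite /p !hornerE; ring.
have hd y : p^`().[y] = - 1 + 2 * k * y.
  by rewrite /p !(derivB, derivD, derivN, derivZ, derivXn, derivX) !hornerE /= ?hornerE; ring.
have : p.[0] <= 1 * ln (1 + 1 * z) + p.[z].
  apply: ler_ln_poly => // x /andP[x0 xz]; first by lra.
  rewrite hd (_ : _ + _ = x ^+ 2 / (1 + x)); last by rewrite /k; field; lra.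
  by rewrite divr_ge0 ?sqr_ge0 ?mulr_ge0; lra.
by rewrite !hp ?mul1r ?mulN1r expr0n /= [z ^+ 2 / _]mulrC -/k; lra.
Qed.

Lemma ln1D_le z b : 0 <= z <= b -> ln (1 + z) <= z - z ^+ 2 / (2 * (1 + b)).
Proof.
move=> /andP[z0 zb]; pose k : R := (2 * (1 + b))^-1; pose p : {poly R} := 'X - k *: 'X^2.
have hp y : p.[y] = y - k * y ^+ 2 by rewrite /p !hornerE; ring.
have hd y : p^`().[y] = 1 - 2 * k * y.
  by rewrite /p !(derivB, derivD, derivN, derivZ, derivXn, derivX) !hornerE /= ?hornerE; ring.
have : p.[0] <= -1 * ln (1 + 1 * z) + p.[z].
  apply: ler_ln_poly => // x /andP[x0 xz]; first by lra.
  rewrite hd (_ : _ + _ = x * (b - x) / ((1 + x) * (1 + b))); last by rewrite /k; field; lra.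
  by rewrite divr_ge0 ?sqr_ge0 ?mulr_ge0; lra.
by rewrite !hp ?mul1r ?mulN1r expr0n /= [z ^+ 2 / _]mulrC -/k; lra.
Qed.

Lemma ln1B_le u : 0 <= u < 1 -> ln (1 - u) <= - u - u ^+ 2 / 2.
Proof.
move=> /andP[u0 u1]; pose k : R := 2^-1; pose p : {poly R} := - 'X - k *: 'X^2.
have hp y : p.[y] = - y - k * y ^+ 2 by rewrite /p !hornerE; ring.
have hd y : p^`().[y] = - 1 - 2 * k * y.
  by rewrite /p !(derivB, derivD, derivN, derivZ, derivXn, derivX) !hornerE /= ?hornerE; ring.
have : p.[0] <= -1 * ln (1 + -1 * u) + p.[u].
  apply: ler_ln_poly => // x /andP[x0 xz]; first by lra.
  rewrite hd (_ : _ + _ = x ^+ 2 / (1 - x)); last by rewrite /k; field; lra.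
  by rewrite divr_ge0 ?sqr_ge0 ?mulr_ge0; lra.
by rewrite !hp ?mul1r ?mulN1r expr0n /= [u ^+ 2 / _]mulrC -/k; lra.
Qed.

Lemma ln1B_ge u b : 0 <= u <= b -> b < 1 -> - u - u ^+ 2 / (2 * (1 - b)) <= ln (1 - u).
Proof.
move=> /andP[u0 ub] b1; pose k : R := (2 * (1 - b))^-1; pose p : {poly R} := 'X + k *: 'X^2.
have hp y : p.[y] = y + k * y ^+ 2 by rewrite /p !hornerE; ring.
have hd y : p^`().[y] = 1 + 2 * k * y.
  by rewrite /p !(derivB, derivD, derivN, derivZ, derivXn, derivX) !hornerE /= ?hornerE; ring.
have : p.[0] <= 1 * ln (1 + -1 * u) + p.[u].
  apply: ler_ln_poly => // x /andP[x0 xz]; first by lra.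
  rewrite hd (_ : _ + _ = x * (b - x) / ((1 - x) * (1 - b))); last by rewrite /k; field; lra.
  by rewrite divr_ge0 ?sqr_ge0 ?mulr_ge0; lra.
by rewrite !hp ?mul1r ?mulN1r expr0n /= [u ^+ 2 / _]mulrC -/k; lra.
Qed.

(** Markov's inequality for a Poisson variable of mean [z]: terms with [i >= n] are at most [i / n]
    times themselves, so the tail is at most [(z / n) expR z], half of the total. *)
Lemma sum_exp_coeff_ge_half z n : (0 < n)%N -> 0 <= z -> 2 * z <= n%:R ->
  expR z / 2 <= \sum_(0 <= i < n) z ^+ i / i`!%:R.
Proof.
move=> n0 z0 zn; set S := leRHS.
have c0 i : 0 <= z ^+ i / i`!%:R by rewrite divr_ge0 ?exprn_ge0.
have n_gt0 : 0 < n%:R :> R by rewrite ltr0n.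
have t0 i : 0 <= n%:R^-1 * (i%:R * (z ^+ i / i`!%:R)).
  by apply: mulr_ge0; [rewrite invr_ge0 | apply: mulr_ge0].
have : expR z <= S + z / n%:R * expR z.
  apply: limr_le; first exact: is_cvg_series_exp_coeff.
  near=> m; have nm : (n <= m)%N by near: m; exact: nbhs_infty_ge.
  rewrite /series /= (big_cat_nat (leq0n n) nm)//= lerD2l.
  apply: le_trans (_ : n%:R^-1 * (\sum_(0 <= i < m.+1) i%:R * (z ^+ i / i`!%:R)) <= _).
    rewrite mulr_sumr [leRHS](big_cat_nat (leq0n n) (leqW nm))//= -[leLHS]add0r lerD//.
      by apply: sumr_ge0 => i _; exact: t0.
    rewrite big_nat_recr//= -[leLHS]addr0 lerD ?t0//.
    rewrite !big_nat; apply: ler_sum => i /andP[ni _]; rewrite /exp_coeff /= (mulrA n%:R^-1) ler_peMl//.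
    by rewrite mulrC ler_pdivlMr// mul1r ler_nat.
  rewrite big_nat_recl//= mul0r add0r mulrC [z / _]mulrC -mulrA mulrC ler_pM2l ?invr_gt0//.
  apply: le_trans (ler_wpM2l z0 (sum_exp_coeff_le m z0)).
  rewrite mulr_sumr; apply: ler_sum => i _; rewrite factS natrM exprS.
  have i1 : 1 + i%:R != 0 :> R by rewrite addrC natr1 pnatr_eq0.
  have fi : i`!%:R != 0 :> R by rewrite pnatr_eq0 -lt0n fact_gt0.
  by rewrite le_eqVlt; apply/orP; left; apply/eqP; field; rewrite i1 fi.
have : z / n%:R * expR z <= expR z / 2.
  by rewrite mulrC ler_pM2l ?expR_gt0// ler_pdivrMr//; lra.
lra.
Unshelve. all: by end_near. Qed.

End RealInequalities.

(** * Monotonicity and lower bounds for iterated averages *)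

Section MeanBounds.
Variable R : realType.
Implicit Types (P Q : {poly R}).

Lemma is_derive_average P (x : R) : is_derive x 1 (horner ('X * average P)) P.[x].
Proof. by rewrite -{2}[P]averageK; exact: is_derive_poly. Qed.

Lemma average_ge0 P : (forall y, 0 <= y <= 1 -> 0 <= P.[y]) ->
  forall y, 0 <= y <= 1 -> 0 <= (average P).[y].
Proof.
move=> P0 y /andP[y0 y1]; move: y0; rewrite le_eqVlt => /predU1P[<-|y0].
  by rewrite horner_coef0 coef_average divr1 -horner_coef0 P0// lexx ler01.
have : ('X * average P).[0] <= ('X * average P).[y].
  apply: (ler_derive (ltW y0) (fun x _ => is_derive_average P x)) => x /andP[x0 xy].
  by rewrite P0// ltW//= ltW// (lt_le_trans xy).
by rewrite !hornerE ?mul0r pmulr_rge0.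
Qed.

Lemma iter_average_ge0 P k : (forall y, 0 <= y <= 1 -> 0 <= P.[y]) ->
  forall y, 0 <= y <= 1 -> 0 <= (iter k (@average R) P).[y].
Proof. by move=> P0; elim: k => //= k; exact: average_ge0. Qed.

Lemma mean_le l P Q : (forall y, 0 <= y <= 1 -> P.[y] <= Q.[y]) -> mean l P <= mean l Q.
Proof.
move=> PQ; rewrite -subr_ge0 -mulN1r -meanZ -meanD.
apply: iter_average_ge0; last by rewrite ler01 lexx.
by move=> y /PQ; rewrite !hornerE mulN1r subr_ge0.
Qed.

Lemma mean_ge0 l P : (forall y, 0 <= y <= 1 -> 0 <= P.[y]) -> 0 <= mean l P.
Proof. by move=> P0; apply: iter_average_ge0; rewrite ?ler01 ?lexx. Qed.

(** The function ['X * average Q] is the primitive of [Q] vanishing at 0. The first one is at least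
    [B (v - u)] beyond [v]; each further one integrates the previous bound against [dx / x] from
    [v], which turns [(ln x - ln v)^l / l!] into the next such term. *)
Lemma mean_ge l P (B u v : R) : 0 <= B -> 0 < u -> u <= v -> v <= 1 ->
  (forall y, 0 <= y <= 1 -> 0 <= P.[y]) -> (forall y, u <= y <= v -> B <= P.[y]) ->
  B * (v - u) * ((- ln v) ^+ l / l`!%:R) <= mean l P.
Proof.
move=> B0 u0 uv v1 P0 PB; have v0 : 0 < v by lra.
have itP k : 'X * (iter k.+1 (@average R) P) = 'X * average (iter k (@average R) P) by [].
suff H y : v <= y <= 1 ->
    B * (v - u) * ((ln y - ln v) ^+ l / l`!%:R) <= ('X * iter l.+1 (@average R) P).[y].
  by have := H 1; rewrite v1 lexx ln1 sub0r hornerM hornerX mul1r; apply.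
elim: l y => [|l IH] y /andP[vy y1].
  rewrite expr0 fact0 divr1 mulr1 /=; set S := 'X * _.
  have dS (x : R) : is_derive x 1 (horner S) P.[x] := is_derive_average P x.
  have S0 : S.[0] = 0 by rewrite !hornerE ?mul0r.
  have S1 : S.[0] <= S.[u].
    by apply: (ler_derive (ltW u0) (fun x _ => dS x)) => x /andP[x0 xy]; apply: P0; lra.
  have S3 : S.[v] <= S.[y].
    by apply: (ler_derive vy (fun x _ => dS x)) => x /andP[x0 xy]; apply: P0; lra.
  have S2 : (S - B *: 'X).[u] <= (S - B *: 'X).[v].
    apply: (ler_derive uv (df := fun x => P.[x] - B)) => x /andP[x0 xv].
      have -> : horner (S - B *: 'X) = horner S - horner (B *: 'X).
        by apply/funext => z; rewrite hornerD hornerN.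
      apply: is_deriveB; have := is_derive_poly (B *: 'X) x.
      by rewrite derivZ derivX hornerZ hornerC mulr1.
    by rewrite subr_ge0 PB// !ltW.
  move: S1 S2 S3; rewrite S0 !(hornerD, hornerN, hornerZ, hornerX); lra.
set S := 'X * _; set beta := B * (v - u) in IH *.
pose f (x : R) := S.[x] - beta / l.+1`!%:R * (ln x - ln v) ^+ l.+1.
suff : f v <= f y.
  rewrite /f subrr expr0n /= mulr0 subr0 mulrA [beta * _ / _]mulrAC => H.
  rewrite -subr_ge0 (le_trans _ H)// !hornerE mulr_ge0 ?(ltW v0)//.
  by apply: (@iter_average_ge0 P l.+2 P0); lra.
pose df (x : R) := (iter l.+1 (@average R) P).[x] - beta / l`!%:R * (ln x - ln v) ^+ l / x.
apply: (ler_derive vy (df := df)) => x /andP[vx xy]; have x0 : 0 < x by lra.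
  pose g : R -> R := (@ln R) - cst (ln v).
  have dg : is_derive x 1 g x^-1.
    by rewrite -[x^-1]subr0; apply: is_deriveB; exact: is_derive1_ln.
  have -> : f = horner S - (beta / l.+1`!%:R) *: (g ^+ l.+1).
    apply/funext => z; rewrite /f /g /=; congr (_ - _ * _).
    by elim: (l.+1) => // k; rewrite !exprS => ->.
  have := @is_deriveX _ _ _ l.+1 _ _ _ dg.
  move=> /(@is_deriveZ _ _ _ _ (beta / l.+1`!%:R)).
  have := is_derive_average (iter l.+1 (@average R) P) x.
  move=> /is_deriveB /[apply] /is_derive_eq; apply; rewrite /df /g /=; congr (_ - _).
  rewrite factS natrM.
  rewrite -[LHS]/(beta / (l.+1%:R * l`!%:R) * (l.+1%:R * (ln x - ln v) ^+ l * x^-1)).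
  have := gt_eqF x0; have : l.+1%:R != 0 :> R by rewrite pnatr_eq0.
  have : l`!%:R != 0 :> R by rewrite pnatr_eq0 -lt0n fact_gt0.
  move: (l`!%:R) (l.+1%:R) ((ln x - ln v) ^+ l) => c d e c0 d0 x1.
  by field; rewrite c0 d0 x1.
rewrite /df subr_ge0 ler_pdivrMr// [leRHS]mulrC.
have := IH x; rewrite hornerM hornerX mulrA mulrAC; apply.
by rewrite !ltW// (lt_le_trans xy).
Qed.

End MeanBounds.

(** * Gaussian bounds for the integrand at fixed [N] *)

Section KrawtchoukBounds.
Variables (R : realType) (lambda : R) (N : nat).
Hypotheses (lambda_gt0 : 0 < lambda) (N_gt0 : (0 < N)%N).
Implicit Types (u b z : R) (k n m : nat).

Local Notation gamma := (odds lambda N).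
Local Notation P := (krawtchouk_gen lambda N).

Lemma horner_krawtchouk_gen k u :
  (P k).[u] = (1 - u) ^+ (N - k) * (1 + gamma * u) ^+ k.
Proof. by rewrite /krawtchouk_gen !hornerE. Qed.

Let N0 : 0 < N%:R :> R. Proof. by rewrite ltr0n. Qed.

Lemma oddsE : gamma = lambda^-1 + lambda^-1 / N%:R.
Proof. by rewrite /odds -natr1; field; rewrite !gt_eqF. Qed.

Lemma odds_ge : lambda^-1 <= gamma.
Proof. by rewrite oddsE lerDl divr_ge0 ?invr_ge0 ?ltW. Qed.

Lemma odds_gt0 : 0 < gamma.
Proof. by rewrite (lt_le_trans _ odds_ge)// invr_gt0. Qed.

Lemma odds_le : gamma <= 2 * lambda^-1.
Proof.
rewrite oddsE [2 * _]mulr_natl mulr2n lerD2l ler_pdivrMr//.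
by rewrite ler_peMr ?invr_ge0 ?ler1n// ltW.
Qed.

Lemma krawtchouk_gen_ge0 k u : 0 <= u <= 1 -> 0 <= (P k).[u].
Proof.
move=> /andP[u0 u1]; have g0 := odds_gt0.
have gu : 0 <= gamma * u by rewrite mulr_ge0// ltW.
by rewrite horner_krawtchouk_gen; apply: mulr_ge0; apply: exprn_ge0; lra.
Qed.

(** Derivative at [u = 0] of the logarithm of [(P k).[u]]. *)
Definition drift k : R := (1 + gamma) * k%:R - N%:R.

Lemma exp1B_le u m : 0 <= u <= 1 -> (1 - u) ^+ m <= expR (m%:R * (- u - u ^+ 2 / 2)).
Proof.
move=> /andP[u0]; rewrite le_eqVlt => /predU1P[->|u1].
  case: m => [|m]; first by rewrite mul0r expR0.
  by rewrite subrr expr0n expR_ge0.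
rewrite expRM_natl lerXn2r ?nnegrE ?expR_ge0 ?subr_ge0 ?(ltW u1)//.
by rewrite -ler_ln ?posrE ?expR_gt0 ?subr_gt0// expRK ln1B_le ?u0.
Qed.

Lemma exp1D_le z b m : 0 <= z <= b ->
  (1 + z) ^+ m <= expR (m%:R * (z - z ^+ 2 / (2 * (1 + b)))).
Proof.
move=> zb; have /andP[z0 _] := zb; have z1 : 0 < 1 + z by lra.
rewrite expRM_natl lerXn2r ?nnegrE ?expR_ge0 ?(ltW z1)//.
by rewrite -ler_ln ?posrE ?expR_gt0// expRK ln1D_le.
Qed.

Lemma krawtchouk_gen_le k u b : (k <= N)%N -> 0 <= u <= 1 -> gamma * u <= b ->
  (P k).[u] <= expR (drift k * u - (N%:R - k%:R + k%:R * gamma ^+ 2 / (1 + b)) * u ^+ 2 / 2).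
Proof.
move=> kN u01 ub; have /andP[u0 u1] := u01; have g0 := odds_gt0.
have gu0 : 0 <= gamma * u by rewrite mulr_ge0// ltW.
rewrite horner_krawtchouk_gen.
apply: le_trans (_ : expR ((N - k)%:R * (- u - u ^+ 2 / 2)) *
  expR (k%:R * (gamma * u - (gamma * u) ^+ 2 / (2 * (1 + b)))) <= _).
  by apply: ler_pM; [apply: exprn_ge0; lra | apply: exprn_ge0; lra | exact: exp1B_le |
    apply: exp1D_le; rewrite gu0].
rewrite -expRD ler_expR natrB// le_eqVlt; apply/orP; left; apply/eqP.
rewrite /drift; field; lra.
Qed.

(** A constant below both 1 and [gamma^2 / (1 + gamma)], the second-order contributions of an empty
    and of a sleeping site, for every [gamma] between [1 / lambda] and [2 / lambda]. It is crude but
    uniform in [k] and [u]. *)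
Definition curvature : R := (lambda^-1 / (1 + 2 * lambda^-1)) ^+ 2.

Lemma curvature_gt0 : 0 < curvature.
Proof. by rewrite exprn_gt0// divr_gt0 ?addr_gt0 ?mulr_gt0 ?invr_gt0. Qed.

Lemma krawtchouk_gen_le_quad k u : (k <= N)%N -> 0 <= u <= 1 ->
  (P k).[u] <= expR (drift k * u - N%:R * curvature * u ^+ 2 / 2).
Proof.
move=> kN u01; have /andP[u0 u1] := u01; have g0 := odds_gt0.
apply: (le_trans (krawtchouk_gen_le kN u01 (b := gamma) _)); first by rewrite ler_piMr// ltW.
rewrite ler_expR lerD2l lerN2 ler_pM2r ?invr_gt0// ler_wpM2r ?sqr_ge0//.
set l := lambda^-1; have l0 : 0 < l by rewrite invr_gt0.
have gl : l <= gamma := odds_ge; have gl2 : gamma <= 2 * l := odds_le.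
have c1 : curvature <= 1.
  by rewrite /curvature -/l expr_le1 ?divr_ge0//; rewrite ?ler_pdivrMr; lra.
have c2 : curvature <= gamma ^+ 2 / (1 + gamma).
  rewrite /curvature -/l expr_div_n; apply: ler_pM; rewrite ?sqr_ge0 ?invr_ge0 ?sqr_ge0//.
    by rewrite lerXn2r ?nnegrE// ltW.
  rewrite lef_pV2 ?posrE ?exprn_gt0; nra.
have -> : N%:R * curvature = (N%:R - k%:R) * curvature + k%:R * curvature by ring.
by apply: lerD; [rewrite ler_piMr// subr_ge0 ler_nat | rewrite -mulrA ler_wpM2l].
Qed.

Lemma krawtchouk_gen_le_drift k u : (k <= N)%N -> 0 <= u <= 1 ->
  (P k).[u] <= expR (drift k * u).
Proof.
move=> kN u01; apply: le_trans (krawtchouk_gen_le_quad kN u01) _.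
rewrite ler_expR gerBl; have := curvature_gt0 => c0.
by rewrite divr_ge0// mulr_ge0 ?sqr_ge0// mulr_ge0// ltW.
Qed.

Lemma quad_le (t D u : R) : 0 < D -> t * u - D * u ^+ 2 / 2 <= t ^+ 2 / (2 * D).
Proof.
move=> D0; rewrite ler_pdivlMr ?mulr_gt0//.
have := sqr_ge0 (t - D * u); nra.
Qed.

Lemma krawtchouk_gen_le_sqr k u : (k <= N)%N -> 0 <= u <= 1 ->
  (P k).[u] <= expR (drift k ^+ 2 / (2 * (N%:R * curvature))).
Proof.
move=> kN u01; apply: le_trans (krawtchouk_gen_le_quad kN u01) _.
by rewrite ler_expR quad_le// mulr_gt0// curvature_gt0.
Qed.

(** The main part vanishes at density [lambda / (1 + lambda)], which is where the critical density
    comes from. The last term is due to the [N + 1] in [odds] and stays bounded. *)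
Lemma driftE k : drift k = (1 + lambda^-1) * (k%:R - lambda / (1 + lambda) * N%:R)
  + lambda^-1 * (k%:R / N%:R).
Proof.
have l1 : 1 + lambda != 0 by rewrite gt_eqF// addr_gt0.
by rewrite /drift oddsE; field; rewrite l1 !gt_eqF.
Qed.

Lemma drift_le k : (k <= N)%N ->
  drift k <= (1 + lambda^-1) * (k%:R - lambda / (1 + lambda) * N%:R) + lambda^-1.
Proof.
move=> kN; rewrite driftE lerD2l ler_piMr ?invr_ge0 ?(ltW lambda_gt0)//.
by rewrite ler_pdivrMr// mul1r ler_nat.
Qed.

Lemma exp1B_ge u b m : 0 <= u <= b -> b < 1 ->
  expR (m%:R * (- u - u ^+ 2 / (2 * (1 - b)))) <= (1 - u) ^+ m.
Proof.
move=> ub b1; have u1 : 0 < 1 - u by lra.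
rewrite expRM_natl lerXn2r ?nnegrE ?expR_ge0 ?(ltW u1)//.
by rewrite -ler_ln ?posrE ?expR_gt0// expRK ln1B_ge.
Qed.

Lemma exp1D_ge z m : 0 <= z -> expR (m%:R * (z - z ^+ 2 / 2)) <= (1 + z) ^+ m.
Proof.
move=> z0; have z1 : 0 < 1 + z by lra.
rewrite expRM_natl lerXn2r ?nnegrE ?expR_ge0 ?(ltW z1)//.
by rewrite -ler_ln ?posrE ?expR_gt0// expRK ln1D_ge.
Qed.

Lemma krawtchouk_gen_ge k u b : (k <= N)%N -> 0 <= u <= b -> b < 1 ->
  expR ((N%:R - k%:R) * (- u - u ^+ 2 / (2 * (1 - b))) +
        k%:R * (lambda^-1 * u - (lambda^-1 * u) ^+ 2 / 2)) <= (P k).[u].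
Proof.
move=> kN ub b1; have /andP[u0 u1] := ub.
have l0 : 0 < lambda^-1 by rewrite invr_gt0.
have lu : 0 <= lambda^-1 * u by rewrite mulr_ge0// ltW.
rewrite horner_krawtchouk_gen expRD -natrB//; apply: ler_pM; rewrite ?expR_ge0//.
  exact: exp1B_ge.
apply: le_trans (exp1D_ge k lu) _.
have gu : lambda^-1 * u <= gamma * u by rewrite ler_wpM2r// odds_ge.
by rewrite lerXn2r ?nnegrE; lra.
Qed.

End KrawtchoukBounds.

(** * Asymptotics as the number of sites grows *)

Section Asymptotics.
Variable R : realType.
Implicit Types (A b c x y eta delta : R) (N k n m : nat).

Definition dev N : R := Num.sqrt (N%:R * ln N%:R).

Lemma near_ln_ge A : \forall N \near \oo, A <= ln (N%:R : R).
Proof.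
near=> N; rewrite -[A]expRK ler_ln ?posrE ?expR_gt0//; last first.
  by rewrite ltr0n; near: N; exact: nbhs_infty_gt.
by near: N; exact: nbhs_infty_ger.
Unshelve. all: by end_near. Qed.

(** Powers of [N] are written as exponentials of [c * ln N] throughout; the cubic term of the
    exponential already absorbs the square of the logarithm. *)
Lemma near_ln_sqr_le c A : 0 < c -> 0 < A ->
  \forall N \near \oo, A * ln (N%:R : R) ^+ 2 <= expR (c * ln (N%:R : R)).
Proof.
move=> c0 A0; near=> N.
have : 1 <= ln (N%:R : R) by near: N; exact: near_ln_ge.
have : 6 * A / c ^+ 3 <= ln (N%:R : R) by near: N; exact: near_ln_ge.
set l := ln _ => lA l1.
have cl : 0 <= c * l by rewrite mulr_ge0; lra.
apply: le_trans (expR_ge1Dxn 2 cl); rewrite -[leLHS]add0r lerD//.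
rewrite ler_pdivrMr ?exprn_gt0// in lA.
rewrite (_ : 3`!%:R = 6)// ler_pdivlMr// exprMn.
by have := ler_wpM2r (sqr_ge0 l) lA; rewrite !exprS !expr0 !mulr1; nra.
Unshelve. all: by end_near. Qed.

Lemma natr_expR_ln N : (0 < N)%N -> N%:R = expR (ln (N%:R : R)).
Proof. by move=> N0; rewrite lnK// posrE ltr0n. Qed.

Lemma dev_ge0 N : 0 <= dev N. Proof. exact: sqrtr_ge0. Qed.

Lemma sqr_dev N : (0 < N)%N -> dev N ^+ 2 = N%:R * ln N%:R.
Proof. by move=> N0; rewrite sqr_sqrtr// mulr_ge0// ln_ge0// ler1n. Qed.

Lemma dev_le N : (0 < N)%N -> 1 <= ln (N%:R : R) ->
  dev N <= ln N%:R * expR (2^-1 * ln N%:R).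
Proof.
move=> N0 l1; rewrite -(ler_pXn2r (ltn0Sn 1)) ?nnegrE ?dev_ge0//; last first.
  by rewrite mulr_ge0 ?expR_ge0//; lra.
rewrite sqr_dev// exprMn [expR _ ^+ 2]expr2 -expRD -mulrDl (_ : 2^-1 + 2^-1 = 1); last by field.
rewrite mul1r -natr_expR_ln// [leLHS]mulrC ler_wpM2r// ler_peMl//; lra.
Qed.

Lemma dev_ge N : (0 < N)%N -> 1 <= ln (N%:R : R) -> expR (2^-1 * ln N%:R) <= dev N.
Proof.
move=> N0 l1; rewrite -(ler_pXn2r (ltn0Sn 1)) ?nnegrE ?dev_ge0 ?expR_ge0//.
rewrite sqr_dev// [leLHS]expr2 -expRD -mulrDl (_ : 2^-1 + 2^-1 = 1); last by field.
by rewrite mul1r -natr_expR_ln// ler_peMr.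
Qed.

Lemma near_dev_le delta : 0 < delta -> \forall N \near \oo, dev N <= delta * N%:R.
Proof.
move=> d0; near=> N.
have N0 : (0 < N)%N by near: N; exact: nbhs_infty_gt.
have l1 : 1 <= ln (N%:R : R) by near: N; exact: near_ln_ge.
have : delta^-1 * ln (N%:R : R) ^+ 2 <= expR (2^-1 * ln (N%:R : R)).
  by near: N; apply: near_ln_sqr_le; rewrite ?invr_gt0.
rewrite ler_pdivrMl// => H; apply: le_trans (dev_le N0 l1) _.
rewrite [N%:R in leRHS]natr_expR_ln// (_ : ln N%:R = 2^-1 * ln N%:R + 2^-1 * ln N%:R :> R); last by field.
rewrite expRD mulrA -mulrDl (_ : 2^-1 + 2^-1 = 1) ?mul1r; last by field.
rewrite ler_wpM2r ?expR_ge0//; apply: le_trans H.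
by rewrite expr2 ler_peMr//; lra.
Unshelve. all: by end_near. Qed.

Lemma near_dev_ge A : \forall N \near \oo, A <= dev N.
Proof.
near=> N.
have N0 : (0 < N)%N by near: N; exact: nbhs_infty_gt.
have l1 : 1 <= ln (N%:R : R) by near: N; exact: near_ln_ge.
have lA : A <= ln (N%:R : R) by near: N; exact: near_ln_ge.
apply: le_trans lA _; apply: le_trans (dev_ge N0 l1).
apply: le_trans (_ : 1 * ln (N%:R : R) ^+ 2 <= _); first by rewrite mul1r expr2 ler_peMr//; lra.
by near: N; apply: near_ln_sqr_le.
Unshelve. all: by end_near. Qed.

Variable lambda : R.
Hypothesis lambda_gt0 : 0 < lambda.

Let l := lambda^-1.
Let l_gt0 : 0 < l. Proof. by rewrite invr_gt0. Qed.
Let rho := lambda / (1 + lambda).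

Let rhoE : (1 + l) * rho = 1.
Proof. by rewrite /l /rho; field; rewrite !gt_eqF// addr_gt0. Qed.

Let rho_gt0 : 0 < rho. Proof. by rewrite divr_gt0// addr_gt0. Qed.
Let rho_lt1 : rho < 1. Proof. by rewrite ltr_pdivrMr ?mul1r ?addr_gt0// ltrDr. Qed.

Local Notation P N := (krawtchouk_gen lambda N).
Local Notation excess N k := (k%:R - rho * N%:R).

Let scaleE b N : (0 < N)%N ->
  ((1 + l) * (b * dev N)) ^+ 2 / (N%:R * l) = b ^+ 2 * ((1 + lambda) ^+ 2 / lambda) * ln N%:R.
Proof.
move=> N0; rewrite !exprMn sqr_dev// /l; field.
by rewrite pnatr_eq0 -lt0n N0 gt_eqF.
Qed.

(** The exponent is at most [t u - D u^2 / 2], with maximum [t^2 / (2 D)]. Here [t] is about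
    [(1 + l) b dev N] and [D] about [N l], and [(1 + l)^2 / l] equals [(1 + lambda)^2 / lambda]. *)
Lemma krawtchouk_gen_upper b eta : 0 < b -> 0 < eta < 1 -> \forall N \near \oo,
  forall k (u : R), (k <= N)%N -> 0 <= excess N k <= b * dev N -> 0 <= u <= 1 ->
  (P N k).[u] <= expR (b ^+ 2 * ((1 + lambda) ^+ 2 / lambda) / (2 * (1 - eta) ^+ 4) * ln N%:R).
Proof.
move=> b0 /andP[e0 e1]; have e1' : 0 < 1 - eta by lra.
(* As [odds] is at most [2 l], this cutoff ensures [odds * u <= eta] for [u <= kappa], where the
   sharp second-order term is available. *)
pose kappa := eta / (2 * l); have kappa0 : 0 < kappa by rewrite divr_gt0// mulr_gt0.
have d0 := curvature_gt0 lambda_gt0; set d := curvature lambda in d0.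
have lb0 : 0 < (1 + l) * b by rewrite mulr_gt0// addr_gt0.
have dk0 : 0 < d * kappa / 4 by rewrite divr_gt0// mulr_gt0.
near=> N => k u kN /andP[x0 xb] u01.
have N0 : (0 < N)%N by near: N; exact: nbhs_infty_gt.
have NR : 0 < N%:R :> R by rewrite ltr0n.
have lN0 : 0 <= ln (N%:R : R) by rewrite ln_ge0// ler1n.
have E2 : b * dev N <= eta * l * N%:R.
  rewrite -ler_pdivlMl// mulrA; near: N; apply: near_dev_le.
  by rewrite mulr_gt0 ?invr_gt0// mulr_gt0.
(* [T] bounds the drift of all the [k] concerned: it is negligible with respect to [N], and equal to
   [(1 + l) b dev N] up to a factor [1 - eta]. *)
pose T := (1 + l) * (b * dev N) + l.
have E1 : T <= N%:R * d * kappa / 2.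
  have l1 : (1 + l) * b * dev N <= d * kappa / 4 * N%:R.
    rewrite -ler_pdivlMl// mulrA; near: N; apply: near_dev_le.
    by apply: mulr_gt0; [rewrite invr_gt0 | exact: dk0].
  have l2 : l <= d * kappa / 4 * N%:R.
    by rewrite -ler_pdivrMl//; near: N; exact: nbhs_infty_ger.
  by rewrite /T; lra.
have E3 : T * (1 - eta) <= (1 + l) * (b * dev N).
  have : l <= eta * ((1 + l) * b) * dev N.
    rewrite -(ler_pdivrMl _ _ (mulr_gt0 e0 lb0)); near: N; exact: near_dev_ge.
  by rewrite /T; nra.
have t0 : 0 <= drift lambda N k.
  rewrite driftE// -/l -/rho; apply: addr_ge0; apply: mulr_ge0 => //; [by rewrite addr_ge0// ltW | exact: ltW].
have tT : drift lambda N k <= T.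
  by apply: le_trans (drift_le _ _ kN) _ => //; rewrite /T lerD2r ler_wpM2l// addr_ge0// ltW.
have ex0 : 0 <= b ^+ 2 * ((1 + lambda) ^+ 2 / lambda) / (2 * (1 - eta) ^+ 4) * ln N%:R.
  apply: mulr_ge0 => //; apply: divr_ge0; last by rewrite mulr_ge0// exprn_ge0// ltW.
  by rewrite mulr_ge0 ?sqr_ge0// divr_ge0 ?sqr_ge0// ltW.
have /andP[u0 u1] := u01.
(* Beyond [kappa] the crude curvature suffices: since [T] is small compared with [N], the exponent
   is nonpositive. *)
have [uk|ku] := lerP u kappa; last first.
  apply: le_trans (krawtchouk_gen_le_quad lambda_gt0 N0 kN u01) _; rewrite ler_expR.
  apply: le_trans ex0; rewrite -/d.
  have : u * (drift lambda N k - N%:R * d * u / 2) <= 0.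
    rewrite mulr_ge0_le0// subr_le0 (le_trans tT)// (le_trans E1)//.
    have Nd0 : 0 < N%:R * d by rewrite mulr_gt0.
    by rewrite ler_pM2r ?invr_gt0// (ler_pM2l Nd0) ltW.
  by lra.
have g2 := odds_le lambda_gt0 N0; have g1 := odds_ge lambda_gt0 N0; rewrite -/l in g1 g2.
have gu : odds lambda N * u <= eta.
  apply: le_trans (ler_wpM2r u0 g2) _; apply: le_trans (ler_wpM2l _ uk) _; first by rewrite mulr_ge0// ltW.
  by rewrite /kappa mulrC divfK// gt_eqF// mulr_gt0.
apply: le_trans (krawtchouk_gen_le lambda_gt0 N0 kN u01 gu) _; rewrite ler_expR.
set D := N%:R - k%:R + _.
have D_ge : (1 - eta) ^+ 2 * (N%:R * l) <= D.
  have h1 : (1 - eta) * (k%:R * l ^+ 2) <= k%:R * odds lambda N ^+ 2 / (1 + eta).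
    rewrite ler_pdivlMr ?addr_gt0//.
    have h2 : l ^+ 2 <= odds lambda N ^+ 2 by rewrite lerXn2r ?nnegrE// ltW// (lt_le_trans l_gt0).
    apply: le_trans (ler_wpM2l (ler0n R k) h2).
    have := mulr_ge0 (ler0n R k) (sqr_ge0 l) => h3; have := mulr_ge0 h3 (sqr_ge0 eta); nra.
  have h4 : (1 - eta) * (N%:R - k%:R) <= N%:R - k%:R.
    by rewrite ler_piMl ?subr_ge0 ?ler_nat//; lra.
  have h5 : (1 - eta) * (N%:R * l) <= (N%:R - k%:R) + k%:R * l ^+ 2.
    have h6 : k%:R = rho * N%:R + excess N k by ring.
    (* At density [rho] the second-order contributions [1 - rho] of the empty sites and [rho l^2] of
       the sleeping ones add up to [l]. *)
    have h7 : N%:R - rho * N%:R + rho * N%:R * l ^+ 2 = N%:R * l.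
      have -> : N%:R - rho * N%:R = N%:R * (1 + l) * rho - rho * N%:R by rewrite -mulrA rhoE mulr1.
      have -> : N%:R * l = N%:R * ((1 + l) * rho) * l by rewrite rhoE mulr1.
      by ring.
    have h8 : 0 <= excess N k * l ^+ 2 by rewrite mulr_ge0 ?sqr_ge0.
    by rewrite h6; lra.
  apply: le_trans (_ : (1 - eta) * ((N%:R - k%:R) + k%:R * l ^+ 2) <= _).
    by rewrite expr2 -mulrA ler_wpM2l//; lra.
  by rewrite /D; lra.
have NL0 : 0 < (1 - eta) ^+ 2 * (N%:R * l) by rewrite mulr_gt0 ?exprn_gt0 ?mulr_gt0//; lra.
apply: le_trans (quad_le _ _ (lt_le_trans NL0 D_ge)) _.
(* Two of the four factors [1 - eta] come from [D_ge], and two from the square of the bound [E3] on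
   the drift. *)
have -> : b ^+ 2 * ((1 + lambda) ^+ 2 / lambda) / (2 * (1 - eta) ^+ 4) * ln N%:R =
   ((1 + l) * (b * dev N) / (1 - eta)) ^+ 2 / (2 * ((1 - eta) ^+ 2 * (N%:R * l))).
  rewrite mulrAC -scaleE//; field; rewrite gt_eqF// gt_eqF//=; lra.
rewrite ler_pM ?sqr_ge0 ?invr_ge0//.
- by rewrite mulr_ge0// ltW// (lt_le_trans NL0).
- rewrite lerXn2r ?nnegrE//; last by apply: le_trans tT _; rewrite ler_pdivlMr.
  by rewrite divr_ge0 ?(ltW e1')// mulr_ge0 ?mulr_ge0 ?dev_ge0 ?(ltW b0)// addr_ge0// ltW.
- have D0 : 0 < 2 * D by rewrite mulr_gt0// (lt_le_trans NL0).
  have NL2 : 0 < 2 * ((1 - eta) ^+ 2 * (N%:R * l)) by rewrite mulr_gt0.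
  by rewrite lef_pV2 ?posrE// ler_pM2l.
Unshelve. all: by end_near. Qed.

End Asymptotics.

(** * Lower bounds above the critical level *)

Section LowerAsymptotics.
Variables (R : realType) (lambda : R).
Hypothesis lambda_gt0 : 0 < lambda.
Implicit Types (b c x y eta delta : R) (N k n m : nat).

Local Notation rho := (lambda / (1 + lambda)).
Local Notation P N := (krawtchouk_gen lambda N).
Local Notation excess N k := (k%:R - rho * N%:R).
Local Notation snr := ((1 + lambda) ^+ 2 / lambda).

(* Close to the maximizer of the polynomial on [0, 1]. *)
Definition peak b N : R := (1 + lambda^-1) * b * dev R N / (N%:R * lambda^-1).

Lemma near_peak_le b delta : 0 < b -> 0 < delta -> \forall N \near \oo, peak b N <= delta.
Proof.
move=> b0 d0; have lb0 : 0 < (1 + lambda^-1) * b by rewrite mulr_gt0// addr_gt0 ?invr_gt0.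
have c0 : 0 < ((1 + lambda^-1) * b)^-1 * (delta * lambda^-1).
  by apply: mulr_gt0; [rewrite invr_gt0 | rewrite mulr_gt0 ?invr_gt0].
near=> N; have N0 : 0 < N%:R :> R by rewrite ltr0n; near: N; exact: nbhs_infty_gt.
rewrite /peak ler_pdivrMr ?mulr_gt0 ?invr_gt0//.
rewrite -ler_pdivlMl//.
have -> : ((1 + lambda^-1) * b)^-1 * (delta * (N%:R * lambda^-1)) =
  ((1 + lambda^-1) * b)^-1 * (delta * lambda^-1) * N%:R by ring.
by near: N; exact: near_dev_le.
Unshelve. all: by end_near. Qed.

(** The same interval near [peak b N] serves every [k] whose excess is at least [b dev R N]: for
    these small [u] the exponent increases with the excess, so the maximizer attached to each [k]
    can be ignored. *)
Lemma krawtchouk_gen_lower b eta : 0 < b -> 0 < eta -> \forall N \near \oo,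
  forall k (u : R), (k <= N)%N -> b * dev R N <= excess N k ->
  (1 - eta) * peak b N <= u <= peak b N -> 0 <= u ->
  expR (b ^+ 2 * snr * ((1 - 3 * eta) / 2) * ln N%:R) <= (P N k).[u].
Proof.
move=> b0 e0; set l := lambda^-1; have l0 : 0 < l by rewrite invr_gt0.
have rhoE : (1 + l) * rho = 1 by rewrite /l; field; rewrite !gt_eqF// addr_gt0.
have rho0 : 0 < rho by rewrite divr_gt0// addr_gt0.
have rho1 : rho < 1 by rewrite ltr_pdivrMr ?mul1r ?addr_gt0// ltrDr.
have c1 : 0 < 2^-1 :> R by rewrite invr_gt0.
have c2 : 0 < (1 + l) / l ^+ 2 by rewrite divr_gt0 ?exprn_gt0 ?addr_gt0.
have c3 : 0 < eta * l / 4 by rewrite divr_gt0// mulr_gt0.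
have c4 : 0 < eta * l / 2 / (b * l ^+ 2) by rewrite !divr_gt0 ?mulr_gt0 ?exprn_gt0.
near=> N => k u kN x_ge /andP[uv1 uv] u0.
have N0 : (0 < N)%N by near: N; exact: nbhs_infty_gt.
have NR : 0 < N%:R :> R by rewrite ltr0n.
have v1 : peak b N <= 2^-1 by near: N; exact: near_peak_le.
have v2 : peak b N <= (1 + l) / l ^+ 2 by near: N; exact: near_peak_le.
have v3 : peak b N <= eta * l / 4 by near: N; exact: near_peak_le.
have s3 : dev R N <= eta * l / 2 / (b * l ^+ 2) * N%:R by near: N; exact: near_dev_le.
have NlE : N%:R * l * peak b N = (1 + l) * (b * dev R N).
  by rewrite /peak -/l mulrC divfK ?mulrA// gt_eqF// mulr_gt0.
have scale : N%:R * l * peak b N ^+ 2 = b ^+ 2 * snr * ln N%:R.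
  have -> : N%:R * l * peak b N ^+ 2 = ((1 + l) * (b * dev R N)) ^+ 2 / (N%:R * l).
    by rewrite /peak -/l; field; rewrite !gt_eqF.
  by rewrite !exprMn sqr_dev// /l; field; rewrite !gt_eqF.
have vlt1 : peak b N < 1 by lra.
set v := peak b N in v1 v2 v3 NlE scale vlt1 uv uv1 *.
have uu : 0 <= u <= v by rewrite u0.
apply: le_trans (krawtchouk_gen_ge lambda_gt0 N0 kN uu vlt1); rewrite ler_expR -/l.
pose w := (1 - v)^-1.
have v0 : 0 <= v by lra.
have w0 : 0 < w by rewrite invr_gt0; lra.
have w1 : w <= 1 + 2 * v by rewrite -[w]mul1r ler_pdivrMr; nra.
set x := excess N k in x_ge *.
have kE : k%:R = rho * N%:R + x by rewrite /x; ring.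
clearbody x; set r := rho in rhoE rho0 rho1 kE; clearbody r.
(* The exponent is expanded around density [r]; the last term, linear in [u] and of order [N],
   vanishes by [rhoE]. *)
have E1 : (N%:R - k%:R) * (- u - u ^+ 2 / (2 * (1 - v))) +
    k%:R * (l * u - (l * u) ^+ 2 / 2) =
    x * u * ((1 + l) - l ^+ 2 * u / 2) + x * w * u ^+ 2 / 2
    - ((1 - r) * w + r * l ^+ 2) * N%:R * u ^+ 2 / 2 +
    ((1 + l) * r - 1) * N%:R * u.
  have -> : (2 * (1 - v))^-1 = w / 2 by rewrite invfM mulrC.
  by rewrite kE; field.
rewrite E1 rhoE subrr !mul0r addr0.
set s := dev R N in s3 x_ge NlE *.
have s0 : 0 <= s by exact: sqrtr_ge0.
have bs0 : 0 <= b * s by rewrite mulr_ge0// ltW.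
have l2u : l ^+ 2 * u <= 1 + l.
  have h : l ^+ 2 * v <= 1 + l by rewrite mulrC -ler_pdivlMr ?exprn_gt0.
  by apply: le_trans h; rewrite ler_wpM2l ?sqr_ge0.
have F1 : b * s * u * ((1 + l) - l ^+ 2 * u / 2) <= x * u * ((1 + l) - l ^+ 2 * u / 2).
  by apply: ler_wpM2r; [lra | rewrite ler_wpM2r].
have F2 : 0 <= x * w * u ^+ 2 / 2.
  by rewrite divr_ge0// mulr_ge0 ?sqr_ge0// mulr_ge0 ?(ltW w0)// (le_trans bs0).
have F3 : ((1 - r) * w + r * l ^+ 2) * N%:R + b * s * l ^+ 2 <= N%:R * l * (1 + eta).
  have g1 : (1 - r) * w <= (1 - r) + 2 * v.
    apply: le_trans (ler_wpM2l _ w1) _; first lra.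
    by have := mulr_ge0 (ltW rho0) v0; lra.
  have g2 : 1 - r + r * l ^+ 2 = l.
    rewrite -[X in X - r]rhoE; have -> : (1 + l) * r - r + r * l ^+ 2 = l * ((1 + l) * r) by ring.
    by rewrite rhoE mulr1.
  have g3 : b * s * l ^+ 2 <= eta * l / 2 * N%:R.
    have bl : 0 < b * l ^+ 2 by rewrite mulr_gt0// exprn_gt0.
    have -> : eta * l / 2 * N%:R = b * l ^+ 2 * (eta * l / 2 / (b * l ^+ 2) * N%:R).
      by field; rewrite !gt_eqF.
    by rewrite mulrAC; exact: (ler_wpM2l (ltW bl) s3).
  have g4 : ((1 - r) * w + r * l ^+ 2) * N%:R <= (l + eta * l / 2) * N%:R.
    by rewrite ler_wpM2r//; lra.
  lra.
have F4 := ler_wpM2r (divr_ge0 (sqr_ge0 u) (ler0n R 2)) F3.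
have F5 : (1 - eta) * v * (N%:R * l * v) <= u * (N%:R * l * v).
  by rewrite ler_wpM2r// mulr_ge0// mulr_ge0// ltW.
have F6 : N%:R * l * (1 + eta) * (u ^+ 2 / 2) <= N%:R * l * (1 + eta) * (v ^+ 2 / 2).
  rewrite ler_wpM2l//; first by rewrite !mulr_ge0 ?addr_ge0// ltW.
  by rewrite ler_pM2r ?invr_gt0// lerXn2r ?nnegrE.
rewrite mulrAC -scale.
(* The loss [3 eta] adds [2 eta] from the linear term, taken at [u >= (1 - eta) v], to [eta] from
   the quadratic one, increased by the factor [1 + eta]. *)
have -> : N%:R * l * v ^+ 2 * ((1 - 3 * eta) / 2) =
  (1 - eta) * v * (N%:R * l * v) - N%:R * l * (1 + eta) * (v ^+ 2 / 2) by field.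
have F7 : b * s * u * ((1 + l) - l ^+ 2 * u / 2) = u * (N%:R * l * v) - b * s * l ^+ 2 * (u ^+ 2 / 2).
  by rewrite NlE; field.
lra.
Unshelve. all: by end_near. Qed.

(** With [v = peak b N], [mean_ge] on the interval from [(1 - eta) v] to [v] yields a multiple
    [eta v] of a partial sum of the series of [expR (- ln v) = 1 / v], so [v] cancels. As
    [v >= 1 / N], having [L >= 2 ln N] terms keeps at least half of that series. *)
Lemma sum_mean_lower b eta : 0 < b -> 0 < eta < 1 -> \forall N \near \oo,
  forall k (L : nat), (k <= N)%N -> b * dev R N <= excess N k -> (0 < L)%N ->
  2 * ln (N%:R : R) <= L%:R ->
  eta / 2 * expR (b ^+ 2 * snr * ((1 - 3 * eta) / 2) * ln N%:R) <=
  \sum_(0 <= i < L) mean i (P N k).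
Proof.
move=> b0 /andP[e0 e1].
have lb0 : 0 < (1 + lambda^-1) * b by rewrite mulr_gt0// addr_gt0 ?invr_gt0.
near=> N => k L kN x_ge L0 LN.
have N0 : (0 < N)%N by near: N; exact: nbhs_infty_gt.
have NR : 0 < N%:R :> R by rewrite ltr0n.
have v1 : peak b N <= 1 by near: N; exact: near_peak_le.
have sN : ((1 + lambda^-1) * b)^-1 * lambda^-1 <= dev R N by near: N; exact: near_dev_ge.
have Nv : N%:R^-1 <= peak b N.
  rewrite ler_pdivrMl// in sN.
  by rewrite /peak ler_pdivlMr ?mulr_gt0 ?invr_gt0// mulrA mulVf ?gt_eqF// mul1r.
have low : forall u, (1 - eta) * peak b N <= u <= peak b N -> 0 <= u ->
    expR (b ^+ 2 * snr * ((1 - 3 * eta) / 2) * ln N%:R) <= (P N k).[u].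
  move=> u; move: k u kN x_ge {LN L0 L}; near: N.
  by have := krawtchouk_gen_lower b0 e0; apply: filterS => N H k u kN; exact: H.
set B := expR _ in low *; set v := peak b N in v1 Nv low.
have v0 : 0 < v by rewrite (lt_le_trans _ Nv)// invr_gt0.
have tau0 : 0 <= - ln v by rewrite oppr_ge0 ln_le0.
have tauN : 2 * - ln v <= L%:R.
  apply: le_trans LN; rewrite ler_pM2l// lerNl -lnV ?posrE// ler_ln ?posrE ?invr_gt0//.
have half := sum_exp_coeff_ge_half L0 tau0 tauN.
rewrite expRN lnK ?posrE// in half.
apply: le_trans (_ : \sum_(0 <= i < L) B * (v - (1 - eta) * v) * ((- ln v) ^+ i / i`!%:R) <= _).
  rewrite -mulr_sumr; have B0 : 0 < B := expR_gt0 _.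
  have -> : v - (1 - eta) * v = eta * v by ring.
  apply: le_trans (ler_wpM2l _ half); last by apply: mulr_ge0; [exact: ltW | apply: mulr_ge0; exact: ltW].
  by rewrite le_eqVlt; apply/orP; left; apply/eqP; field; rewrite gt_eqF.
apply: ler_sum => i _; apply: mean_ge => //.
- exact: expR_ge0.
- by rewrite mulr_gt0//; lra.
- by rewrite ler_piMl ?(ltW v0)//; lra.
- by move=> y y01; exact: krawtchouk_gen_ge0.
- move=> y yv; apply: low => //; case/andP: yv => + _; apply: le_trans.
  by rewrite mulr_ge0 ?(ltW v0)//; lra.
Unshelve. all: by end_near. Qed.

End LowerAsymptotics.

(** * Weights of the [k] far above [n] *)

Section FarBound.
Variables (R : realType) (lambda : R).
Hypothesis lambda_gt0 : 0 < lambda.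
Implicit Types (b c x y eta delta : R) (N k n m : nat).

Local Notation rho := (lambda / (1 + lambda)).
Local Notation P N := (krawtchouk_gen lambda N).

Lemma mean_polyC i (c : R) : mean i c%:P = c.
Proof. by rewrite -alg_polyC -(expr0 'X) meanZ meanXn expr1n invr1 mulr1. Qed.

(* Near 0 the polynomial is at most [expR (drift / N ^ 2)]; elsewhere its maximum
   is beaten by a large power of [N ^ 2 * u], whose mean is tiny. *)
Lemma krawtchouk_gen_le_poly N k m (y : R) : (0 < N)%N -> (k <= N)%N -> 0 <= y <= 1 ->
  (P N k).[y] <= ((expR (`|drift lambda N k| / N%:R ^+ 2))%:P +
    (expR (drift lambda N k ^+ 2 / (2 * (N%:R * curvature lambda))) * N%:R ^+ (2 * m))
      *: 'X^m).[y].
Proof.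
move=> N0 kN y01; have /andP[y0 y1] := y01; have NR : 0 < N%:R :> R by rewrite ltr0n.
rewrite hornerD hornerC hornerZ hornerXn.
have [yN|Ny] := lerP y (N%:R ^+ 2)^-1.
  rewrite -[leLHS]addr0 lerD//; last by rewrite !mulr_ge0 ?expR_ge0 ?exprn_ge0.
  apply: le_trans (krawtchouk_gen_le_drift lambda_gt0 N0 kN y01) _; rewrite ler_expR.
  by apply: le_trans (ler_wpM2r y0 (ler_norm _)) _; rewrite ler_wpM2l.
rewrite -[leLHS]add0r lerD ?expR_ge0// -mulrA.
apply: le_trans (krawtchouk_gen_le_sqr lambda_gt0 N0 kN y01) _.
rewrite ler_peMr ?expR_ge0// exprM -exprMn exprn_ege1//.
by rewrite mulrC -ler_pdivrMr ?exprn_gt0// mul1r ltW.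
Qed.

(** Write [j = k - n]. The maximum of the integrand is at most [expR (C1 (j + ln N + 1))], because
    the drift is of order at most [j + dev R N + 1] and [j <= N]. The mean of ['X^m] is
    [(m + 1)^-(j + 1)], which for a large fixed [m] wins over this and over [N^(2 m)] as soon as
    [j >= C ln N]. The constant part of the majorant tends to 1. *)
Lemma mean_upper_far b delta : 0 < b -> 0 < delta -> exists2 C : R, 0 < C &
  \forall N \near \oo, forall n k, (n <= k <= N)%N -> rho * N%:R <= n%:R ->
    n%:R <= rho * N%:R + b * dev R N -> C * ln N%:R <= (k - n)%:R ->
    mean (k - n) (P N k) <= 1 + delta.
Proof.
move=> b0 d0; set l := lambda^-1; have l0 : 0 < l by rewrite invr_gt0.
have c0 := curvature_gt0 lambda_gt0; set d := curvature lambda in c0.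
(* The 3 comes from bounding the square of a sum of three terms by three times the sum of their
   squares. *)
pose C1 := 3 * ((1 + l) ^+ 2 * (1 + b ^+ 2) + l ^+ 2) / d.
have C10 : 0 <= C1.
  by rewrite divr_ge0 ?(ltW c0)// mulr_ge0// addr_ge0 ?sqr_ge0// mulr_ge0 ?sqr_ge0// addr_ge0 ?sqr_ge0.
have [m mC] : exists m : nat, expR (C1 + 1) <= m.+1%:R.
  exists (Num.truncn (expR (C1 + 1))); exact/ltW/truncnS_gt.
(* With this constant the total exponent [C1 (j + ln N + 1) + 2 m ln N - (C1 + 1) (j + 1)] is at
   most [- ln N]. *)
exists (2 * C1 + 2 * m%:R + 1); first by rewrite ltr_wpDl// addr_ge0// mulr_ge0.
near=> N => n k /andP[nk kN] n_ge n_le far.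
have N0 : (0 < N)%N by near: N; exact: nbhs_infty_gt.
have NR : 0 < N%:R :> R by rewrite ltr0n.
have N1 : 1 <= N%:R :> R by rewrite ler1n.
have L1 : 1 <= ln (N%:R : R) by near: N; exact: near_ln_ge.
have Nd : (1 + 2 * l) / ln (1 + delta / 2) <= N%:R by near: N; exact: nbhs_infty_ger.
have Nd2 : 2 / delta <= N%:R by near: N; exact: nbhs_infty_ger.
have d2 : 0 < delta / 2 by rewrite divr_gt0.
have ld0 : 0 < ln (1 + delta / 2) by rewrite ln_gt0// ltrDl.
set L := ln N%:R in L1 far *; set t := drift lambda N k.
pose j : R := (k - n)%:R; have jE : j = k%:R - n%:R by rewrite /j natrB.
have j0 : 0 <= j by rewrite ler0n.
have jN : j <= N%:R by rewrite ler_nat (leq_trans (leq_subr _ _)).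
set s := dev R N in n_le.
have s0 : 0 <= s by exact: sqrtr_ge0.
have sE : s ^+ 2 = N%:R * L by rewrite sqr_dev.
have x0 : 0 <= k%:R - rho * N%:R by rewrite subr_ge0 (le_trans n_ge)// ler_nat.
have x_le : k%:R - rho * N%:R <= j + b * s by rewrite jE; lra.
have t0 : 0 <= t.
  by rewrite /t driftE// -/l; apply: addr_ge0; apply: mulr_ge0 => //; [rewrite addr_ge0// ltW | exact: ltW].
have t_le : t <= (1 + l) * (j + b * s) + l.
  by apply: le_trans (drift_le lambda_gt0 N0 kN) _; rewrite lerD2r ler_wpM2l// addr_ge0// ltW.
have tN : t <= (1 + 2 * l) * N%:R.
  have : k%:R - rho * N%:R <= N%:R.
    have kNR : k%:R <= N%:R :> R by rewrite ler_nat.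
    have : 0 <= rho * N%:R by rewrite mulr_ge0// divr_ge0 ?(ltW lambda_gt0)// addr_ge0// ltW.
    lra.
  move=> /(ler_wpM2l (_ : 0 <= 1 + l)) H.
  apply: le_trans (drift_le lambda_gt0 N0 kN) _; rewrite -/l.
  have lN : l <= l * N%:R by rewrite ler_peMr// ltW.
  have := H (addr_ge0 ler01 (ltW l0)); lra.
have t2 : t ^+ 2 / (2 * (N%:R * d)) <= C1 * (j + L + 1).
  have Nd0 : 0 < 2 * (N%:R * d) by apply: mulr_gt0 => //; exact: mulr_gt0.
  rewrite (ler_pdivrMr _ _ Nd0).
  have -> : C1 * (j + L + 1) * (2 * (N%:R * d)) =
    6 * N%:R * ((1 + l) ^+ 2 * (1 + b ^+ 2) + l ^+ 2) * (j + L + 1).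
    by rewrite /C1; field; rewrite gt_eqF.
  have h1 : t ^+ 2 <= ((1 + l) * (j + b * s) + l) ^+ 2.
    by rewrite lerXn2r ?nnegrE// (le_trans t0).
  have h2 : ((1 + l) * (j + b * s) + l) ^+ 2 <=
      3 * ((1 + l) ^+ 2 * j ^+ 2 + (1 + l) ^+ 2 * b ^+ 2 * s ^+ 2 + l ^+ 2).
    set p := (1 + l) * j; set q := (1 + l) * b * s.
    have -> : (1 + l) * (j + b * s) + l = p + q + l by rewrite /p /q; ring.
    have -> : (1 + l) ^+ 2 * j ^+ 2 + (1 + l) ^+ 2 * b ^+ 2 * s ^+ 2 = p ^+ 2 + q ^+ 2.
      by rewrite /p /q; ring.
    have := sqr_ge0 (p - q); have := sqr_ge0 (p - l); have := sqr_ge0 (q - l).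
    clearbody p q; rewrite !expr2; lra.
  have h3 : j ^+ 2 <= N%:R * j by rewrite expr2 ler_wpM2r.
  rewrite sE in h2.
  have a1 : 0 <= (1 + l) ^+ 2 by exact: sqr_ge0.
  have a2 : 0 <= (1 + l) ^+ 2 * b ^+ 2 by rewrite mulr_ge0 ?sqr_ge0.
  have a3 : 0 <= l ^+ 2 by exact: sqr_ge0.
  have Nj : 0 <= N%:R * j by rewrite mulr_ge0.
  have NL : 0 <= N%:R * L by rewrite mulr_ge0//; lra.
  have b1 := ler_wpM2l a1 h3.
  have b2 := mulr_ge0 a1 NL; have b3 := mulr_ge0 a1 (ltW NR).
  have b4 := mulr_ge0 a2 Nj; have b5 := mulr_ge0 a2 (ltW NR).
  have b6 := mulr_ge0 a3 Nj; have b7 := mulr_ge0 a3 NL.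
  have b8 : l ^+ 2 <= l ^+ 2 * N%:R by rewrite ler_peMr.
  have b9 := mulr_ge0 a1 Nj; have b10 := mulr_ge0 a2 NL.
  have -> : 6 * N%:R * ((1 + l) ^+ 2 * (1 + b ^+ 2) + l ^+ 2) * (j + L + 1) =
    6 * ((1 + l) ^+ 2 * (N%:R * j) + (1 + l) ^+ 2 * (N%:R * L) + (1 + l) ^+ 2 * N%:R
      + (1 + l) ^+ 2 * b ^+ 2 * (N%:R * j) + (1 + l) ^+ 2 * b ^+ 2 * (N%:R * L)
      + (1 + l) ^+ 2 * b ^+ 2 * N%:R
      + l ^+ 2 * (N%:R * j) + l ^+ 2 * (N%:R * L) + l ^+ 2 * N%:R) by ring.
  lra.
apply: le_trans; first by apply: mean_le => y; exact: (krawtchouk_gen_le_poly m N0 kN).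
rewrite meanD mean_polyC meanZ meanXn -/t.
have A1 : expR (`|t| / N%:R ^+ 2) <= 1 + delta / 2.
  rewrite -ler_ln ?posrE ?expR_gt0 ?addr_gt0// expRK ger0_norm// ler_pdivrMr ?exprn_gt0//.
  apply: le_trans tN _; rewrite expr2 mulrA ler_wpM2r//.
  by rewrite [leRHS]mulrC -ler_pdivrMr.
suff A2 : expR (t ^+ 2 / (2 * (N%:R * d))) * N%:R ^+ (2 * m) / m.+1%:R ^+ (k - n).+1 <= delta / 2.
  by lra.
have m1 : (m.+1%:R ^+ (k - n).+1)^-1 <= expR (- ((C1 + 1) * (j + 1))).
  rewrite expRN lef_pV2 ?posrE ?expR_gt0 ?exprn_gt0 ?ltr0n//.
  by rewrite /j natr1 mulrC expRM_natl lerXn2r ?nnegrE ?expR_ge0.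
have e1 := expR_ge0 (t ^+ 2 / (2 * (N%:R * d))).
apply: le_trans (_ : expR (C1 * (j + L + 1)) * expR ((2 * m)%:R * L) *
    expR (- ((C1 + 1) * (j + 1))) <= _).
  have eN : N%:R ^+ (2 * m) = expR ((2 * m)%:R * L) by rewrite expRM_natl -natr_expR_ln.
  rewrite eN; apply: ler_pM => //.
  by rewrite ler_wpM2r ?expR_ge0// ler_expR.
rewrite -!expRD; apply: le_trans (_ : expR (- L) <= _).
  rewrite ler_expR natrM.
  have : C1 <= C1 * L by rewrite ler_peMr.
  by rewrite -/j in far; lra.
rewrite expRN -natr_expR_ln// -[delta / 2]invrK lef_pV2 ?posrE ?invr_gt0//.
by rewrite invf_div.
Unshelve. all: by end_near. Qed.

End FarBound.

(** * Tail bounds by summing renewal equations over a window *)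

Section RenewalTails.
Variables (R : realType) (lambda : R) (N : nat).
Hypotheses (lambda_gt0 : 0 < lambda) (N_gt0 : (0 < N)%N).
Local Notation P := (krawtchouk_gen lambda N).
Local Notation U := (renewal lambda N).

Variable p : 'I_N.+1 -> R.
Hypothesis p_ge0 : forall k, 0 <= p k.
Hypothesis p_sum1 : \sum_k p k = 1.
Hypothesis p_renewal : forall n, (0 < n <= N)%N -> \sum_(k < N.+1) p k * U k n = 1.

Let mean_P_ge0 i k : 0 <= mean i (P k).
Proof. by apply: mean_ge0 => y; exact: krawtchouk_gen_ge0. Qed.

Let renewal_ge0 k n : 0 <= U k n.
Proof. by rewrite /renewal; case: ifP. Qed.

Lemma sum_mean_renewal k L : (L <= k)%N ->
  \sum_(0 <= i < L) mean i (P k) = \sum_(k - L <= n < k) U k n.+1.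
Proof.
elim: L => [|L IH] Lk; first by rewrite subn0 !big_geq.
rewrite big_nat_recr//= IH ?(ltnW Lk)// [RHS]big_ltn; last by lia.
rewrite (_ : (k - L.+1).+1 = k - L)%N; last by lia.
rewrite addrC; congr (_ + _); rewrite /renewal.
by rewrite (_ : (k - L <= k)%N = true) ?subKn ?(ltnW Lk)//; lia.
Qed.

(** The equations of index [k1 - L + 1] to [k2] are added, each contributing 1. For every [k] in the
    range they include the [L] indices ending at [k], hence give it weight at least [B]. *)
Lemma upper_tail_le k1 k2 L (B : R) : (L <= k1)%N -> (k2 <= N)%N ->
  (forall k, (k1 <= k <= k2)%N -> B <= \sum_(0 <= i < L) mean i (P k)) ->
  B * \sum_(k < N.+1 | (k1 <= k <= k2)%N) p k <= (k2 - (k1 - L))%:R.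
Proof.
move=> Lk1 k2N BP.
have -> : (k2 - (k1 - L))%:R = \sum_(k1 - L <= n < k2) \sum_(k < N.+1) p k * U k n.+1.
  rewrite big_nat (eq_bigr (fun=> 1)); last by move=> n /andP[_ nk2]; rewrite p_renewal//; lia.
  by rewrite -big_nat sumr_const_nat.
rewrite exchange_big /= mulr_sumr big_mkcond /=; apply: ler_sum => k _.
rewrite -mulr_sumr; case: ifP => [/andP[k1k kk2]|_]; last first.
  by rewrite mulr_ge0//; apply: sumr_ge0.
rewrite mulrC ler_wpM2l//; apply: le_trans (BP k _) _; first by rewrite k1k.
rewrite sum_mean_renewal ?(leq_trans Lk1)//.
rewrite [leRHS](@big_cat_nat _ _ _ (k - L)%N)/=; [|lia|lia].
rewrite [X in _ + X](@big_cat_nat _ _ _ k)/=; [|lia|lia].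
by rewrite addrCA lerDl addr_ge0//; apply: sumr_ge0.
Qed.

(** In the sum of the equations [n1] to [n2], the [k] below [n1] have weight 0. Any other [k] gets
    at most [1 + delta] from each equation, and the extra [G] only from the at most [L] indices [n]
    with [n <= k < n + L]. *)
Lemma lower_tail_ge n1 n2 L (delta G : R) : (0 < n1)%N -> (n2 <= N)%N -> 0 <= delta -> 0 <= G ->
  (forall n k, (n1 <= n <= n2)%N -> (n <= k <= N)%N ->
     mean (k - n) (P k) <= 1 + delta + G * (k < n + L)%N%:R) ->
  (n2.+1 - n1)%:R <= (\sum_(k < N.+1 | (n1 <= k)%N) p k) *
     ((n2.+1 - n1)%:R * (1 + delta) + L%:R * G).
Proof.
move=> n10 n2N d0 G0 UP.
have {1}-> : (n2.+1 - n1)%:R = \sum_(n1 <= n < n2.+1) \sum_(k < N.+1) p k * U k n.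
  rewrite big_nat (eq_bigr (fun=> 1)); last by move=> n /andP[? ?]; rewrite p_renewal//; lia.
  by rewrite -big_nat sumr_const_nat.
rewrite exchange_big /= mulr_suml [leRHS]big_mkcond /=; apply: ler_sum => k _.
rewrite -mulr_sumr; case: leqP => [n1k|kn1]; last first.
  rewrite big_nat big1 ?mulr0// => n /andP[n1n _].
  by rewrite /renewal leqNgt (leq_trans kn1 n1n).
rewrite ler_wpM2l//.
apply: le_trans (_ : \sum_(n1 <= n < n2.+1) (1 + delta + G * ((n <= k) && (k < n + L))%N%:R) <= _).
  rewrite !big_nat; apply: ler_sum => n /andP[n1n nn2]; rewrite /renewal.
  case: ifP => nk /=; last by rewrite addr_ge0 ?mulr_ge0 ?addr_ge0.
  by apply: UP; [apply/andP; split | rewrite nk -ltnS ltn_ord].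
rewrite big_split /= sumr_const_nat -[(1 + delta) *+ _]mulr_natl lerD2l -mulr_sumr mulrC ler_wpM2r//.
rewrite -natr_sum ler_nat.
have -> : (\sum_(n1 <= n < n2.+1) ((n <= k) && (k < n + L)) =
    size [seq n <- index_iota n1 n2.+1 | (n <= k) && (k < n + L)])%N.
  by rewrite size_filter -sum1_count [RHS]big_mkcond; apply: eq_bigr => n _; case: ifP.
(* These indices all lie among the [L] consecutive integers starting at [k + 1 - L]. *)
rewrite -[X in (_ <= X)%N](size_iota (k.+1 - L) L); apply: uniq_leq_size.
  by rewrite filter_uniq// iota_uniq.
by move=> n; rewrite mem_filter mem_iota => /andP[/andP[? ?] _]; lia.
Qed.

End RenewalTails.

(** * The two tails and the critical constant *)

Section Concentration.
Variables (R : realType) (lambda : R).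
Hypothesis lambda_gt0 : 0 < lambda.
Implicit Types (b c x y eta delta eps : R) (N k n m : nat).

Local Notation rho := (lambda / (1 + lambda)).
Local Notation a := (Num.sqrt lambda / (1 + lambda)).
Local Notation snr := ((1 + lambda) ^+ 2 / lambda).
Local Notation P N := (krawtchouk_gen lambda N).

Definition is_renewal N (p : 'I_N.+1 -> R) : Prop :=
  [/\ forall k : 'I_N.+1, 0 <= p k, \sum_k p k = 1 &
      forall n, (0 < n <= N)%N -> \sum_(k < N.+1) p k * renewal lambda N k n = 1].

Let a_gt0 : 0 < a. Proof. by rewrite divr_gt0 ?sqrtr_gt0 ?addr_gt0. Qed.

(** [snr] is [a^-2], so at excess [b dev R N] the integrand reaches about [N] to the power
    [(b / a)^2 / 2]; the critical power [1/2] is attained at [b = a]. *)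
Let snrE b : b ^+ 2 * snr = (b / a) ^+ 2.
Proof.
rewrite expr_div_n [a ^+ 2]expr_div_n sqr_sqrtr ?(ltW lambda_gt0)//; field.
by rewrite !gt_eqF ?addr_gt0.
Qed.

Let rho_gt0 : 0 < rho. Proof. by rewrite divr_gt0// addr_gt0. Qed.
Let rho_lt1 : rho < 1. Proof. by rewrite ltr_pdivrMr ?mul1r ?addr_gt0// ltrDr. Qed.

(** Two ranges are treated apart. Between the levels [b] and [2 a] there are order [sqrt (N ln N)]
    equations and the weight is a power of [N] above [1/2]. Above [2 a] all the remaining indices,
    at most [N], are used against a weight of order [N^(3/2)]. *)
Lemma upper_tail b delta : a < b <= 2 * a -> 0 < delta -> \forall N \near \oo,
  forall p : 'I_N.+1 -> R, is_renewal p ->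
  \sum_(k < N.+1 | rho * N%:R + b * dev R N < k%:R) p k <= delta.
Proof.
move=> /andP[ab b2a] d0; have b0 : 0 < b := lt_trans a_gt0 ab.
have ba0 : 0 <= b / a by apply: divr_ge0; exact: ltW.
have ba1 : 1 < (b / a) ^+ 2 by rewrite expr_gt1// ltr_pdivlMr// mul1r.
set q := (b / a) ^+ 2 in ba1.
(* Chosen so that the exponent [q (1 - 3 eta) / 2] is [(q + 1) / 4], which exceeds [1/2] since
   [q > 1]. *)
pose eta := (q - 1) / (6 * q).
have q0 : 0 < q by lra.
have e0 : 0 < eta by apply: divr_gt0; lra.
have e1 : eta < 1 by rewrite ltr_pdivrMr; lra.
have qE : q * ((1 - 3 * eta) / 2) = (q + 1) / 4 by rewrite /eta; field; rewrite gt_eqF.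
have tw0 : 0 < 2 * a by rewrite mulr_gt0.
(* At level [2 a] the square is 4, and the value [12^-1] for [eta] gives the exponent
   [4 (3/4) / 2]. *)
have p2 : (2 * a) ^+ 2 * snr * ((1 - 3 * 12^-1) / 2) = 3 / 2.
  by rewrite snrE mulfK ?gt_eqF//; field.
have g1 : 0 < (q + 1) / 4 - 2^-1 by lra.
have g2 : 0 < (delta / 2 * (eta / 2))^-1 * (2 * a + 3) 
  by apply: mulr_gt0; [rewrite invr_gt0; apply: mulr_gt0; exact: divr_gt0 | exact: addr_gt0].
have g3 : 0 < (delta / 2 * (12^-1 / 2))^-1 :> R by rewrite invr_gt0; apply: mulr_gt0; exact: divr_gt0.
have g4 : 0 < (1 - rho) / (2 * a) by rewrite divr_gt0// subr_gt0.
have e12 : 0 < (12^-1 : R) < 1 by lra.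
have e01 : 0 < eta < 1 by rewrite e0.
near=> N => p [p0 p1 pr].
have N0 : (0 < N)%N by near: N; exact: nbhs_infty_gt.
have NR : 0 < N%:R :> R by rewrite ltr0n.
have L1 : 1 <= ln (N%:R : R) by near: N; exact: near_ln_ge.
have s_le := dev_le N0 L1.
have s0 := dev_ge0 R N.
have LN : 3 / rho * ln (N%:R : R) ^+ 2 <= expR (1 * ln (N%:R : R)).
  by near: N; apply: near_ln_sqr_le => //; exact: divr_gt0.
have B1 : (delta / 2 * (eta / 2))^-1 * (2 * a + 3) * ln (N%:R : R) ^+ 2 <=
    expR (((q + 1) / 4 - 2^-1) * ln (N%:R : R)).
  by near: N; exact: near_ln_sqr_le.
have B2 : (delta / 2 * (12^-1 / 2))^-1 * ln (N%:R : R) ^+ 2 <= expR (2^-1 * ln (N%:R : R)).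
  by near: N; apply: near_ln_sqr_le.
have sN : dev R N <= (1 - rho) / (2 * a) * N%:R by near: N; exact: near_dev_le.
have low1 : forall k (L : nat), (k <= N)%N -> b * dev R N <= k%:R - rho * N%:R -> (0 < L)%N ->
    2 * ln (N%:R : R) <= L%:R ->
    eta / 2 * expR (b ^+ 2 * snr * ((1 - 3 * eta) / 2) * ln N%:R) <=
    \sum_(0 <= i < L) mean i (P N k).
  by near: N; exact: sum_mean_lower.
have low2 : forall k (L : nat), (k <= N)%N -> 2 * a * dev R N <= k%:R - rho * N%:R -> (0 < L)%N ->
    2 * ln (N%:R : R) <= L%:R ->
    12^-1 / 2 * expR ((2 * a) ^+ 2 * snr * ((1 - 3 * 12^-1) / 2) * ln N%:R) <=
    \sum_(0 <= i < L) mean i (P N k).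
  by near: N; exact: sum_mean_lower.
rewrite p2 in low2; rewrite snrE -/q qE in low1.
clear - lambda_gt0 a_gt0 rho_gt0 rho_lt1 ab b2a d0 b0 q0 ba1 e0 tw0 N0 NR L1 s_le s0 LN B1 B2 sN low1 low2 p0 pr.
clearbody q eta.
set l := ln N%:R in L1 s_le LN B1 B2 low1 low2 *; set s := dev R N in s_le s0 sN low1 low2 *.
have NE : N%:R = expR l by rewrite natr_expR_ln.
pose x := rho * N%:R + b * s; pose y := rho * N%:R + 2 * a * s.
have x0 : 0 <= x by apply: addr_ge0; apply: mulr_ge0 => //; exact: ltW.
have y0 : 0 <= y by apply: addr_ge0; apply: mulr_ge0 => //; exact: ltW.
pose L := (Num.truncn (2 * l)).+1.
have Ll : 2 * l <= L%:R by apply/ltW/truncnS_gt.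
have Lu : L%:R <= 2 * l + 1.
  by rewrite /L -natr1 lerD2r truncn_le; lra.
have l2 : l <= l ^+ 2 by rewrite expr2 ler_peMr//; lra.
have LrN : L%:R <= rho * N%:R.
  rewrite mul1r -NE mulrAC ler_pdivrMr// mulrC in LN.
  by rewrite [leRHS]mulrC; lra.
pose k1 := (Num.truncn x).+1; pose k2 := Num.truncn y.
have k1x : x < k1%:R by exact: truncnS_gt.
have k2y : k2%:R <= y by rewrite truncn_le.
have yN : y <= N%:R.
  have : s * (2 * a) <= (1 - rho) / (2 * a) * N%:R * (2 * a) by rewrite ler_wpM2r// ltW.
  by rewrite mulrAC divfK ?gt_eqF// /y; lra.
have k2N : (k2 <= N)%N by rewrite -(ler_nat R); lra.
have Lk1 : (L <= k1)%N.
  rewrite -(ler_nat R).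
  apply: (le_trans LrN); apply: le_trans (ltW k1x); rewrite /x lerDl.
  by apply: mulr_ge0 => //; exact: ltW.
have Lk2 : (L <= k2.+1)%N.
  rewrite -(ler_nat R).
  apply: (le_trans LrN); apply: le_trans (ltW (truncnS_gt y)); rewrite /y lerDl.
  by apply: mulr_ge0 => //; exact: ltW.
have T1 := @upper_tail_le _ _ _ lambda_gt0 N0 _ p0 pr k1 k2 L (eta / 2 * expR ((q + 1) / 4 * l)) Lk1 k2N.
have T2 := @upper_tail_le _ _ _ lambda_gt0 N0 _ p0 pr k2.+1 N L (12^-1 / 2 * expR (3 / 2 * l)) Lk2 (leqnn N).
have {}T1 : \sum_(k < N.+1 | (k1 <= k <= k2)%N) p k <= delta / 2.
  have C1 : 0 < eta / 2 * expR ((q + 1) / 4 * l) by apply: mulr_gt0; [exact: divr_gt0 | exact: expR_gt0].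
  rewrite -(ler_pM2l C1); apply: le_trans (T1 _) _.
    move=> k /andP[k1k kk2]; apply: low1 => //; first exact: leq_trans k2N.
    have : k1%:R <= k%:R :> R by rewrite ler_nat.
    by move: k1x; rewrite /x; lra.
  have cnt : (k2 - (k1 - L))%:R <= (2 * a + 3) * l ^+ 2 * expR (2^-1 * l).
    have E1 : 1 <= expR (2^-1 * l) by rewrite -[leLHS]expR0 ler_expR; lra.
    have [le|/ltnW lt] := leqP (k1 - L) k2; last first.
      rewrite (eqP lt); apply: mulr_ge0; last exact: expR_ge0.
      by apply: mulr_ge0; [apply: addr_ge0 => //; exact: ltW | exact: sqr_ge0].
    rewrite natrB// natrB//.
    have : k2%:R - (k1%:R - L%:R) <= 2 * a * s + 2 * l + 1.
      have : 0 <= b * s by rewrite mulr_ge0// ltW.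
      by move: k1x k2y; rewrite /x /y; lra.
    move=> /le_trans; apply.
    have E2 : a * s <= a * (l * expR (2^-1 * l)) by rewrite ler_wpM2l// ltW.
    have E3 : l * expR (2^-1 * l) <= l ^+ 2 * expR (2^-1 * l) by rewrite ler_wpM2r ?expR_ge0.
    have E4 : a * (l * expR (2^-1 * l)) <= a * (l ^+ 2 * expR (2^-1 * l)) by rewrite ler_wpM2l// ltW.
    have E5 : l ^+ 2 <= l ^+ 2 * expR (2^-1 * l) by rewrite ler_peMr ?sqr_ge0.
    lra.
  apply: le_trans cnt _.
  rewrite -mulrA ler_pdivrMl in B1; last by apply: mulr_gt0; exact: divr_gt0.
  have -> : (q + 1) / 4 * l = ((q + 1) / 4 - 2^-1) * l + 2^-1 * l by field.
  rewrite expRD.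
  have := ler_wpM2r (expR_ge0 (2^-1 * l)) B1; lra.
have {}T2 : \sum_(k < N.+1 | (k2.+1 <= k <= N)%N) p k <= delta / 2.
  have C1 : 0 < 12^-1 / 2 * expR (3 / 2 * l) by apply: mulr_gt0; [exact: divr_gt0 | exact: expR_gt0].
  rewrite -(ler_pM2l C1); apply: le_trans (T2 _) _.
    move=> k /andP[k2k kN]; apply: low2 => //.
    have : k2.+1%:R <= k%:R :> R by rewrite ler_nat.
    by have := truncnS_gt y; rewrite -/k2 /y; lra.
  apply: le_trans (_ : N%:R <= _); first by rewrite ler_nat leq_subr.
  rewrite ler_pdivrMl in B2; last by apply: mulr_gt0; exact: divr_gt0.
  have -> : 3 / 2 * l = 2^-1 * l + l by field.
  rewrite expRD -NE.
  have h : 1 <= delta / 2 * (12^-1 / 2) * expR (2^-1 * l).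
    by apply: le_trans B2; lra.
  by have := ler_wpM2r (ltW NR) h; lra.
apply: le_trans (_ : \sum_(k < N.+1 | (k1 <= k <= k2)%N) p k +
   \sum_(k < N.+1 | (k2.+1 <= k <= N)%N) p k <= _); last by lra.
rewrite big_mkcond [X in _ <= X + _]big_mkcond [X in _ <= _ + X]big_mkcond -big_split /=.
apply: ler_sum => k _; case: ifPn => [xk|_]; last first.
  by rewrite addr_ge0//; case: ifP.
have k1k : (k1 <= k)%N by rewrite /k1 (truncn_lt_nat _ x0).
have kN : (k <= N)%N by rewrite -ltnS.
rewrite k1k kN /= andbT; by case: (leqP k k2) => _; rewrite ?addr0 ?add0r.
Unshelve. all: by end_near. Qed.

(** The indices [n] run between the levels [a - eps] and [a - eps / 2]. If [k < n + L] then [k] is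
    still below level [b], and its weight is at most [N^q]; otherwise [mean_upper_far] applies.
    Since [L N^q] is negligible with respect to the length of the window, the average weight is at
    most [1 + 2 delta]. *)
Lemma lower_tail eps delta : 0 < eps <= a / 2 -> 0 < delta -> \forall N \near \oo,
  forall p : 'I_N.+1 -> R, is_renewal p ->
  \sum_(k < N.+1 | k%:R < rho * N%:R + (a - eps) * dev R N) p k <= 2 * delta.
Proof.
move=> /andP[eps0 epsa] d0.
pose b := a - eps / 4; pose t := eps / (4 * a).
have b0 : 0 < b by rewrite /b; lra.
have t0 : 0 < t by apply: divr_gt0 => //; apply: mulr_gt0.
have t1 : t <= 1 / 8.
  by rewrite ler_pdivrMr; [lra | exact: mulr_gt0].
(* Here [b / a = 1 - t], and [(1 - eta)^4 >= 1 - t], so that [q <= (1 - t) / 2], below the critical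
   exponent [1/2]. *)
pose eta := t / 4.
have e01 : 0 < eta < 1 by rewrite /eta; lra.
pose q := b ^+ 2 * snr / (2 * (1 - eta) ^+ 4).
have q2 : q < 2^-1.
  have bE : b ^+ 2 * snr = (1 - t) ^+ 2.
    rewrite snrE /b /t; move: a a_gt0 => al al0; congr (_ ^+ 2).
    by field; rewrite gt_eqF.
  rewrite /q bE ltr_pdivrMr; last by rewrite mulr_gt0// exprn_gt0//; lra.
  have h : 1 - t <= (1 - eta) ^+ 4.
    have h2 : 1 - 2 * eta <= (1 - eta) ^+ 2 by have := sqr_ge0 eta; rewrite !expr2; lra.
    have h4 : (1 - 2 * eta) ^+ 2 <= (1 - eta) ^+ 4.
      by rewrite (exprM _ 2 2) lerXn2r ?nnegrE ?sqr_ge0//; rewrite /eta; lra.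
    by have := sqr_ge0 eta; move: h4; rewrite !expr2 /eta; lra.
  have : (1 - t) ^+ 2 < 1 - t by rewrite expr2 gtr_pMl; lra.
  lra.
have [C C0 near_far] := mean_upper_far lambda_gt0 a_gt0 d0.
have g1 : 0 < 2^-1 - q by rewrite subr_gt0.
have g2 : 0 < (delta * (eps / 4))^-1 * (C + 1).
  by apply: mulr_gt0; [rewrite invr_gt0; apply: mulr_gt0 => //; exact: divr_gt0 | exact: addr_gt0].
have g3 : 0 < (eps / 4)^-1 * (C + 1).
  by apply: mulr_gt0; [rewrite invr_gt0; exact: divr_gt0 | exact: addr_gt0].
have g4 : 0 < (1 - rho) / a by apply: divr_gt0 => //; rewrite subr_gt0.
near=> N => p [p0 p1 pr].
have N0 : (0 < N)%N by near: N; exact: nbhs_infty_gt.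
have NR : 0 < N%:R :> R by rewrite ltr0n.
have L1 : 1 <= ln (N%:R : R) by near: N; exact: near_ln_ge.
have s_ge := dev_ge N0 L1.
have s0 := dev_ge0 R N.
have s_eps : 4 / eps <= dev R N by near: N; exact: near_dev_ge.
have B1 : (delta * (eps / 4))^-1 * (C + 1) * ln (N%:R : R) ^+ 2 <=
    expR ((2^-1 - q) * ln (N%:R : R)).
  by near: N; exact: near_ln_sqr_le.
have B2 : (eps / 4)^-1 * (C + 1) * ln (N%:R : R) ^+ 2 <= expR (2^-1 * ln (N%:R : R)).
  by near: N; exact: near_ln_sqr_le.
have sN : dev R N <= (1 - rho) / a * N%:R by near: N; exact: near_dev_le.
have up : forall k (u : R), (k <= N)%N -> 0 <= k%:R - rho * N%:R <= b * dev R N -> 0 <= u <= 1 ->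
    (P N k).[u] <= expR (b ^+ 2 * snr / (2 * (1 - eta) ^+ 4) * ln N%:R).
  by near: N; exact: krawtchouk_gen_upper.
have far : forall n k, (n <= k <= N)%N -> rho * N%:R <= n%:R ->
    n%:R <= rho * N%:R + a * dev R N -> C * ln N%:R <= (k - n)%:R ->
    mean (k - n) (P N k) <= 1 + delta.
  by near: N; exact: near_far.
rewrite -/q in up.
set l := ln N%:R in L1 s_ge B1 B2 up far *; set s := dev R N in s_ge s0 s_eps sN up far *.
clear - lambda_gt0 a_gt0 rho_gt0 rho_lt1 eps0 epsa d0 b0 C0 N0 NR L1 s_ge s0 s_eps B1 B2 sN up far p0 p1 pr.
clearbody q eta.
pose x := rho * N%:R + (a - eps) * s; pose y := rho * N%:R + (a - eps / 2) * s.
have rN0 : 0 <= rho * N%:R by apply: mulr_ge0 => //; exact: ltW.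
have as0 : 0 <= (a - eps) * s by apply: mulr_ge0 => //; lra.
have es0 : 0 <= eps * s by apply: mulr_ge0 => //; exact: ltW.
have x0 : 0 <= x by rewrite /x; lra.
have y0 : 0 <= y by rewrite /y; lra.
pose L := (Num.truncn (C * l)).+1.
have Cl0 : 0 <= C * l by apply: mulr_ge0; lra.
have Lu : L%:R <= C * l + 1 by rewrite /L -natr1 lerD2r truncn_le.
pose n1 := (Num.truncn x).+1; pose n2 := Num.truncn y.
have n1x : x < n1%:R by exact: truncnS_gt.
have n1x1 : n1%:R <= x + 1 by rewrite /n1 -natr1 lerD2r truncn_le.
have n2y : n2%:R <= y by rewrite truncn_le.
have n2y1 : y < n2.+1%:R by exact: truncnS_gt.
have yN : y <= N%:R.
  have : s * a <= (1 - rho) / a * N%:R * a by rewrite ler_wpM2r// ltW.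
  by rewrite mulrAC divfK ?gt_eqF// /y; lra.
have n2N : (n2 <= N)%N by rewrite -(ler_nat R); lra.
have es4 : 1 <= eps / 4 * s by move: s_eps; rewrite ler_pdivrMr//; lra.
have Ll2 : C * l + 1 <= (C + 1) * l ^+ 2.
  have l2 : l <= l ^+ 2 by rewrite expr2 ler_peMr//; lra.
  by have := ler_wpM2l (ltW C0) l2; lra.
have Leps : C * l + 1 <= eps / 4 * s.
  apply: (le_trans Ll2); apply: le_trans (ler_wpM2l _ s_ge); last by lra.
  by rewrite -mulrA ler_pdivrMl in B2; last exact: divr_gt0.
have up_mean n k : (n1 <= n <= n2)%N -> (n <= k <= N)%N ->
    mean (k - n) (P N k) <= 1 + delta + expR (q * l) * (k < n + L)%N%:R.
  move=> /andP[n1n nn2] /andP[nk kN].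
  have n1nR : n1%:R <= n%:R :> R by rewrite ler_nat.
  have nn2R : n%:R <= n2%:R :> R by rewrite ler_nat.
  have nkR : n%:R <= k%:R :> R by rewrite ler_nat.
  have [kL|Lk] := ltnP; last first.
    rewrite mulr0 addr0; apply: far; rewrite ?nk//.
    - by move: n1x; rewrite /x; lra.
    - by move: n2y; rewrite /y; lra.
    - apply/ltW; apply: (lt_le_trans (truncnS_gt _)).
      by rewrite ler_nat leq_subRL.
  rewrite mulr1 -[leLHS]add0r lerD ?addr_ge0 ?(ltW d0)//.
  have kLR : k%:R <= n%:R + L%:R :> R by rewrite -natrD ler_nat ltnW.
  rewrite -[leRHS](mean_polyC (k - n)); apply: mean_le => u u01; rewrite hornerC.
  by apply: up => //; apply/andP; split; move: n1x n2y; rewrite /x /y /b; lra.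
have := lower_tail_ge lambda_gt0 N0 p0 pr (isT : (0 < n1)%N) n2N (ltW d0) (expR_ge0 _) up_mean.
set S := \sum_(k < N.+1 | (n1 <= k)%N) p k; set W := (n2.+1 - n1)%:R => HW.
have n12 : (n1 <= n2.+1)%N.
  by rewrite -(ler_nat R); move: n1x1 n2y1; rewrite /x /y; lra.
have W_ge : eps / 4 * s <= W.
  by rewrite /W natrB//; move: n1x1 n2y1; rewrite /x /y; lra.
have W0 : 0 < W by lra.
have S0 : 0 <= S by apply: sumr_ge0.
have LG : L%:R * expR (q * l) <= delta * W.
  apply: le_trans (_ : delta * (eps / 4 * s) <= _); last by rewrite ler_pM2l.
  apply: le_trans (_ : (C + 1) * l ^+ 2 * expR (q * l) <= _).
    by rewrite ler_wpM2r ?expR_ge0//; lra.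
  rewrite -mulrA ler_pdivrMl in B1; last by apply: mulr_gt0 => //; exact: divr_gt0.
  apply: le_trans (ler_wpM2r (expR_ge0 (q * l)) B1) _.
  rewrite -[leLHS]mulrA -expRD (_ : (2^-1 - q) * l + q * l = 2^-1 * l); last by ring.
  by rewrite [leRHS]mulrA; apply: ler_wpM2l => //; apply: mulr_ge0; [exact: ltW | apply: divr_ge0 => //; exact: ltW].
have S1 : 1 <= S * (1 + 2 * delta).
  rewrite -(ler_pM2l W0); apply: le_trans (_ : S * (W * (1 + delta) + delta * W) <= _).
    by rewrite mulr1; apply: le_trans HW _; rewrite ler_wpM2l// lerD2l.
  by rewrite le_eqVlt; apply/orP; left; apply/eqP; ring.
(* Since [S <= 1], the product [2 delta S] in [S1] is at most [2 delta]. *)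
have S2 : 1 - 2 * delta <= S.
  have S_le : S <= 1 by rewrite -[leRHS]p1 /S big_mkcond; apply: ler_sum => k _; case: ifP.
  have := ler_wpM2l (_ : 0 <= 2 * delta) S_le; move=> H.
  by have := H (mulr_ge0 (ler0n R 2) (ltW d0)); lra.
suff : \sum_(k < N.+1 | k%:R < x) p k + S <= 1 by lra.
rewrite -[leRHS]p1 /S big_mkcond [X in _ + X <= _]big_mkcond -big_split /=.
apply: ler_sum => k _; case: ifPn => kx; last by rewrite add0r; case: ifP.
case: ifP => [n1k|_]; last by rewrite addr0.
by move: kx; rewrite ltNge (le_trans (ltW n1x)) ?ler_nat.
Unshelve. all: by end_near. Qed.

End Concentration.

Lemma stationary_is_renewal (R : realType) (lambda : R) N (m : stable_config N -> R) :
  0 < lambda -> (0 < N)%N -> is_stationary (driven_kernel lambda (N := N)) m ->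
  is_renewal lambda (num_particles_law m).
Proof.
move=> lambda_gt0 N_gt0 st; split.
- by move=> k; apply: sumr_ge0 => xi _; case: st.
- apply: etrans (law_moment lambda_gt0 N_gt0 0 st); apply: eq_bigr => k _; rewrite expr1n invr1 mul1r -horner_coef0.
  by rewrite horner_krawtchouk_gen mulr0 subr0 addr0 !expr1n !mulr1.
- by move=> n nN; exact: (renewal_equation lambda_gt0 N_gt0 st nN).
Qed.

Theorem theorem1p2 (R : realType) (lambda : R) (lambda_gt0 : 0 < lambda)
    (mubar : forall N : nat, stable_config N -> R)
    (mubar_stationary : forall N : nat, (0 < N)%N ->
       is_stationary (driven_kernel lambda (N := N)) (mubar N))
    (eps : R) (eps_gt0 : 0 < eps) :
  let rho_c := lambda / (1 + lambda) in
  let a := Num.sqrt lambda / (1 + lambda) in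
  (fun N : nat =>
     interval_mass (num_particles_law (mubar N))
       `[rho_c * N%:R + (a - eps) * Num.sqrt (N%:R * ln N%:R),
         rho_c * N%:R + (a + eps) * Num.sqrt (N%:R * ln N%:R)])
    @ \oo --> (1 : R).
Proof.
move=> rho a; have a0 : 0 < a by rewrite divr_gt0 ?sqrtr_gt0 ?addr_gt0.
(* The tail bounds concern levels between [a / 2] and [2 a]; reducing [eps] to [e] only shrinks the
   interval. *)
pose e := Num.min eps (a / 2).
have e0 : 0 < e by rewrite lt_min eps_gt0 divr_gt0.
have ea : e <= a / 2 by rewrite ge_min lexx orbT.
have eeps : e <= eps by rewrite ge_min lexx.
apply/cvgrPdist_le => /= delta delta0.
have d4 : 0 < delta / 4 by rewrite divr_gt0.
have d2 : 0 < delta / 2 by rewrite divr_gt0.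
have e_half : 0 < e <= a / 2 by rewrite e0.
have ae : a < a + e <= 2 * a by lra.
near=> N; have N0 : (0 < N)%N by near: N; exact: nbhs_infty_gt.
have up : forall p : 'I_N.+1 -> R, is_renewal lambda p ->
    \sum_(k < N.+1 | rho * N%:R + (a + e) * dev R N < k%:R) p k <= delta / 2.
  by near: N; exact: upper_tail.
have low : forall p : 'I_N.+1 -> R, is_renewal lambda p ->
    \sum_(k < N.+1 | k%:R < rho * N%:R + (a - e) * dev R N) p k <= 2 * (delta / 4).
  by near: N; exact: lower_tail.
have rp := stationary_is_renewal lambda_gt0 N0 (mubar_stationary N N0).
have {}up := up _ rp; have {}low := low _ rp; case: rp => p0 p1 _.
set p := num_particles_law (mubar N) in p0 p1 up low *.
rewrite /interval_mass; set I := Interval _ _.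
have s0 := dev_ge0 R N.
have M1 : \sum_(k < N.+1 | (k : nat)%:R \in I) p k <= 1.
  by rewrite -[leRHS]p1 big_mkcond; apply: ler_sum => k _; case: ifP.
suff : 1 <= \sum_(k < N.+1 | (k : nat)%:R \in I) p k +
   \sum_(k < N.+1 | k%:R < rho * N%:R + (a - e) * dev R N) p k +
   \sum_(k < N.+1 | rho * N%:R + (a + e) * dev R N < k%:R) p k.
  by rewrite ger0_norm ?subr_ge0//; lra.
rewrite -[leLHS]p1 [X in _ <= X + _ + _]big_mkcond [X in _ <= _ + X + _]big_mkcond.
rewrite [X in _ <= _ + X]big_mkcond -!big_split /=.
apply: ler_sum => k _.
have pos (c : bool) : 0 <= (if c then p k else 0) by case: c.
case: ifPn => [_|kI]; first by rewrite -addrA lerDl addr_ge0.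
case: ifPn => [_|kl]; first by rewrite add0r lerDl.
case: ifPn => [_|ku]; first by rewrite !add0r.
case/negP: kI; rewrite /I in_itv /=; rewrite -!leNgt in kl ku.
have : (eps - e) * dev R N >= 0 by rewrite mulr_ge0 ?subr_ge0.
by rewrite -/(dev R N) => ?; apply/andP; split; lra.
Unshelve. all: by end_near. Qed.
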